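(* Let $\mathcal A$ be a unital C$^*$-algebra, $n$ a positive integer and $\mathcal B=\mathcal A\otimes\mathcal M_n(\mathbb C)$. If $x_1,\ldots,x_m$ is a finite family of self-adjoint elements generating $\mathcal A$ and $y_1,\ldots,y_p$ is a finite family of self-adjoint elements generating $\mathcal B$, then $$\mathfrak K_{top}^{(2)}(y_1,\ldots,y_p)\le\mathfrak K_{top}^{(2)}(x_1,\ldots,x_m).$$ (The left side is computed in $\mathcal B$, the right side in $\mathcal A$.)
   Context: Microstates. Let $\mathcal A$ be a unital C$^*$-algebra and $x_1,\dots,x_n$ self-adjoint elements of $\mathcal A$. Let $\{P_r\}_{r\ge1}$ enumerate all noncommutative polynomials in the indeterminates $X_1,\dots,X_n$ whose coefficients have rational real and imaginary parts (constants allowed). $\mathcal M_k^{s.a.}(\mathbb C)$ is the set of self-adjoint $k\times k$ complex matrices and $\tau_k=\frac1k\mathrm{Tr}$. For $R,\epsilon>0$ and $r,k\in\mathbb N$, $\Gamma_R^{(top)}(x_1,\dots,x_n;k,\epsilon,P_1,\dots,P_r)$ is the set of $(A_1,\dots,A_n)\in\mathcal M_k^{s.a.}(\mathbb C)^n$ with $\max_i\|A_i\|\le R$ and $\big|\|P_j(A_1,\dots,A_n)\|-\|P_j(x_1,\dots,x_n)\|\big|\le\epsilon$ for $1\le j\le r$. Covering numbers. On $\mathcal M_k(\mathbb C)^n$ put $\|(A_i)\|_2=(\sum_i\tau_k(A_i^*A_i))^{1/2}$. The $\omega$-orbit ball centred at $(B_i)$ is the set of $(A_i)$ such that some unitary $W\in\mathcal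 M_k(\mathbb C)$ satisfies $\|(A_i)-(WB_iW^* )\|_2<\omega$; for $\Sigma\subseteq\mathcal M_k(\mathbb C)^n$, $o_2(\Sigma,\omega)$ is the minimal number of $\omega$-orbit balls centred at points of $\Sigma$ covering $\Sigma$. Convention $\log 0=-\infty$. Topological orbit dimension: $\mathfrak K^{(2)}_{top}(x_1,\dots,x_n;\omega)=\sup_{R>0}\inf_{\epsilon>0,r\in\mathbb N}\limsup_{k\to\infty}\frac{\log o_2(\Gamma_R^{(top)}(x_1,\dots,x_n;k,\epsilon,P_1,\dots,P_r),\omega)}{k^2}$ and $\mathfrak K_{top}^{(2)}(x_1,\dots,x_n)=\limsup_{\omega\to0^+}\mathfrak K_{top}^{(2)}(x_1,\dots,x_n;\omega)$. *)

(* Defs.v *)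
From Stdlib Require Import Reals QArith Qreals List ClassicalEpsilon.
Open Scope R_scope.

Inductive Rbar := Fin (x : R) | PInf | MInf.

Definition Rbar_le (a b : Rbar) : Prop :=
  match a, b with
  | MInf, _ => True
  | _, PInf => True
  | Fin x, Fin y => x <= y
  | _, _ => False
  end.

Definition is_sup (P : Rbar -> Prop) (l : Rbar) : Prop :=
  (forall x, P x -> Rbar_le x l) /\
  (forall u, (forall x, P x -> Rbar_le x u) -> Rbar_le l u).
Definition is_inf (P : Rbar -> Prop) (l : Rbar) : Prop :=
  (forall x, P x -> Rbar_le l x) /\
  (forall u, (forall x, P x -> Rbar_le u x) -> Rbar_le u l).

(* least upper bound / greatest lower bound in [-oo,+oo] (they always exist) *)
Definition Rbar_sup (P : Rbar -> Prop) : Rbar := epsilon (inhabits PInf) (is_sup P).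
Definition Rbar_inf (P : Rbar -> Prop) : Rbar := epsilon (inhabits PInf) (is_inf P).

Definition limsup_seq (u : nat -> Rbar) : Rbar :=
  Rbar_inf (fun z => exists N : nat, z = Rbar_sup (fun y => exists k, (N <= k)%nat /\ y = u k)).

Definition limsup_0plus (f : R -> Rbar) : Rbar :=
  Rbar_inf (fun z => exists d, 0 < d /\ z = Rbar_sup (fun y => exists w, 0 < w < d /\ y = f w)).

Definition Rbar_real (a : Rbar) : R := match a with Fin x => x | _ => 0 end.

Definition Rbar_log_div (o : Rbar) (k : nat) : Rbar :=
  match o with
  | Fin r => if Rle_dec r 0 then MInf else Fin (ln r / (INR k ^ 2))
  | PInf => PInf
  | MInf => MInf
  end.

Record Cpx := mkC { Re : R; Im : R }.
Definition C0 : Cpx := mkC 0 0.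
Definition C1 : Cpx := mkC 1 0.
Definition Cadd (a b : Cpx) : Cpx := mkC (Re a + Re b) (Im a + Im b).
Definition Copp (a : Cpx) : Cpx := mkC (- Re a) (- Im a).
Definition Csub (a b : Cpx) : Cpx := Cadd a (Copp b).
Definition Cmul (a b : Cpx) : Cpx :=
  mkC (Re a * Re b - Im a * Im b) (Re a * Im b + Im a * Re b).
Definition Cconj (a : Cpx) : Cpx := mkC (Re a) (- Im a).
Definition Cabs2 (a : Cpx) : R := Re a ^ 2 + Im a ^ 2.
Definition Cabs (a : Cpx) : R := sqrt (Cabs2 a).
Definition QQ2C (q : Q * Q) : Cpx := mkC (Q2R (fst q)) (Q2R (snd q)).

Fixpoint Csum (k : nat) (f : nat -> Cpx) : Cpx :=
  match k with O => C0 | S k' => Cadd (Csum k' f) (f k') end.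
Fixpoint Rsum (k : nat) (f : nat -> R) : R :=
  match k with O => 0 | S k' => Rsum k' f + f k' end.

Record CStarAlgebra := {
  car :> Type;
  czero : car; cone : car;
  cadd : car -> car -> car; copp : car -> car; cmul : car -> car -> car;
  csmul : Cpx -> car -> car; cstar : car -> car; cnorm : car -> R;
  cadd_assoc : forall x y z, cadd x (cadd y z) = cadd (cadd x y) z;
  cadd_comm : forall x y, cadd x y = cadd y x;
  cadd_0 : forall x, cadd x czero = x;
  cadd_opp : forall x, cadd x (copp x) = czero;
  csmul_assoc : forall a b x, csmul a (csmul b x) = csmul (Cmul a b) x;
  csmul_1 : forall x, csmul C1 x = x;
  csmul_addr : forall a x y, csmul a (cadd x y) = cadd (csmul a x) (csmul a y);
  csmul_addl : forall a b x, csmul (Cadd a b) x = cadd (csmul a x) (csmul b x);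
  cmul_assoc : forall x y z, cmul x (cmul y z) = cmul (cmul x y) z;
  cmul_1l : forall x, cmul cone x = x;
  cmul_1r : forall x, cmul x cone = x;
  cmul_addl : forall x y z, cmul (cadd x y) z = cadd (cmul x z) (cmul y z);
  cmul_addr : forall x y z, cmul x (cadd y z) = cadd (cmul x y) (cmul x z);
  cmul_smull : forall a x y, cmul (csmul a x) y = csmul a (cmul x y);
  cmul_smulr : forall a x y, cmul x (csmul a y) = csmul a (cmul x y);
  cstar_invol : forall x, cstar (cstar x) = x;
  cstar_add : forall x y, cstar (cadd x y) = cadd (cstar x) (cstar y);
  cstar_smul : forall a x, cstar (csmul a x) = csmul (Cconj a) (cstar x);
  cstar_mul : forall x y, cstar (cmul x y) = cmul (cstar y) (cstar x);
  cnorm_nonneg : forall x, 0 <= cnorm x;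
  cnorm_eq0 : forall x, cnorm x = 0 -> x = czero;
  cnorm_triangle : forall x y, cnorm (cadd x y) <= cnorm x + cnorm y;
  cnorm_smul : forall a x, cnorm (csmul a x) = Cabs a * cnorm x;
  cnorm_submult : forall x y, cnorm (cmul x y) <= cnorm x * cnorm y;
  cnorm_cstar : forall x, cnorm (cmul (cstar x) x) = cnorm x ^ 2;
  ccomplete : forall u : nat -> car,
    (forall e, 0 < e -> exists N, forall p q, (N <= p)%nat -> (N <= q)%nat ->
        cnorm (cadd (u p) (copp (u q))) < e) ->
    exists l, forall e, 0 < e -> exists N, forall p, (N <= p)%nat ->
        cnorm (cadd (u p) (copp l)) < e
}.

Arguments czero {_}. Arguments cone {_}. Arguments cadd {_}. Arguments copp {_}.
Arguments cmul {_}. Arguments csmul {_}. Arguments cstar {_}. Arguments cnorm {_}.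

Definition self_adjoint (A : CStarAlgebra) (x : A) : Prop := cstar x = x.

Definition generates (A : CStarAlgebra) (x : nat -> A) (m : nat) : Prop :=
  forall S : A -> Prop,
    S cone ->
    (forall i, (i < m)%nat -> S (x i)) ->
    (forall a b, S a -> S b -> S (cadd a b)) ->
    (forall c a, S a -> S (csmul c a)) ->
    (forall a b, S a -> S b -> S (cmul a b)) ->
    (forall a, S a -> S (cstar a)) ->
    (forall (u : nat -> A) l, (forall k, S (u k)) ->
        (forall e, 0 < e -> exists N, forall p, (N <= p)%nat ->
           cnorm (cadd (u p) (copp l)) < e) -> S l) ->
    forall a, S a.

(* B is (isomorphic, as a unital *-algebra, to) A ⊗ M_n(C) = M_n(A):
   Psi b i j is the (i,j) entry (i,j < n) of the matrix corresponding to b. *)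
Definition is_tensor_Mn (A : CStarAlgebra) (n : nat) (B : CStarAlgebra)
  (Psi : B -> nat -> nat -> A) : Prop :=
  (forall b c i j, (i < n)%nat -> (j < n)%nat ->
     Psi (cadd b c) i j = cadd (Psi b i j) (Psi c i j)) /\
  (forall a b i j, (i < n)%nat -> (j < n)%nat ->
     Psi (csmul a b) i j = csmul a (Psi b i j)) /\
  (forall b c i j, (i < n)%nat -> (j < n)%nat ->
     Psi (cmul b c) i j =
     fold_right (fun l acc => cadd acc (cmul (Psi b i l) (Psi c l j))) czero (seq 0 n)) /\
  (forall b i j, (i < n)%nat -> (j < n)%nat -> Psi (cstar b) i j = cstar (Psi b j i)) /\
  (forall i j, (i < n)%nat -> (j < n)%nat ->
     Psi cone i j = if Nat.eqb i j then cone else czero) /\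
  (forall b c, (forall i j, (i < n)%nat -> (j < n)%nat -> Psi b i j = Psi c i j) -> b = c) /\
  (forall M : nat -> nat -> A, exists b,
     forall i j, (i < n)%nat -> (j < n)%nat -> Psi b i j = M i j).

(* Polynomials in X_0,...,X_{m-1} with coefficients whose real and imaginary
   parts are rational, represented by expression trees. *)
Inductive ncpoly :=
| PVar (i : nat)
| PConst (q : Q * Q)
| PAdd (P Q : ncpoly)
| PMul (P Q : ncpoly).

Fixpoint vars_lt (m : nat) (P : ncpoly) : Prop :=
  match P with
  | PVar i => (i < m)%nat
  | PConst _ => True
  | PAdd P1 P2 | PMul P1 P2 => vars_lt m P1 /\ vars_lt m P2
  end.

Fixpoint evalA (A : CStarAlgebra) (x : nat -> A) (P : ncpoly) : A :=
  match P with
  | PVar i => x i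
  | PConst q => csmul (QQ2C q) cone
  | PAdd P1 P2 => cadd (evalA A x P1) (evalA A x P2)
  | PMul P1 P2 => cmul (evalA A x P1) (evalA A x P2)
  end.

(* ---------- k x k complex matrices (entries with indices < k) ---------- *)
Definition mat := nat -> nat -> Cpx.
Definition madd (X Y : mat) : mat := fun a b => Cadd (X a b) (Y a b).
Definition msub (X Y : mat) : mat := fun a b => Csub (X a b) (Y a b).
Definition mmul (k : nat) (X Y : mat) : mat :=
  fun a b => Csum k (fun l => Cmul (X a l) (Y l b)).
Definition mscal (c : Cpx) : mat := fun a b => if Nat.eqb a b then c else C0.
Definition madj (X : mat) : mat := fun a b => Cconj (X b a).

Definition mat_selfadj (k : nat) (X : mat) : Prop :=
  forall a b, (a < k)%nat -> (b < k)%nat -> X a b = Cconj (X b a).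

Definition mat_eq (k : nat) (X Y : mat) : Prop :=
  forall a b, (a < k)%nat -> (b < k)%nat -> X a b = Y a b.

Definition unitary (k : nat) (W : mat) : Prop :=
  mat_eq k (mmul k (madj W) W) (mscal C1) /\ mat_eq k (mmul k W (madj W)) (mscal C1).

Definition mat_opnorm (k : nat) (X : mat) : R :=
  Rbar_real (Rbar_sup (fun r => exists v : nat -> Cpx,
      Rsum k (fun j => Cabs2 (v j)) <= 1 /\
      r = Fin (sqrt (Rsum k (fun a => Cabs2 (Csum k (fun j => Cmul (X a j) (v j)))))))).

Definition tau (k : nat) (X : mat) : Cpx :=
  Cmul (mkC (/ INR k) 0) (Csum k (fun a => X a a)).

Fixpoint evalM (k : nat) (T : nat -> mat) (P : ncpoly) : mat :=
  match P with
  | PVar i => T i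
  | PConst q => mscal (QQ2C q)
  | PAdd P1 P2 => madd (evalM k T P1) (evalM k T P2)
  | PMul P1 P2 => mmul k (evalM k T P1) (evalM k T P2)
  end.

Definition norm2 (n k : nat) (T : nat -> mat) : R :=
  sqrt (Rsum n (fun i => Re (tau k (mmul k (madj (T i)) (T i))))).

Definition Gamma_top (A : CStarAlgebra) (x : nat -> A) (m : nat) (Rr : R)
  (k : nat) (eps : R) (L : list ncpoly) (T : nat -> mat) : Prop :=
  (forall i, (i < m)%nat -> mat_selfadj k (T i) /\ mat_opnorm k (T i) <= Rr) /\
  (forall P, In P L -> Rabs (mat_opnorm k (evalM k T P) - cnorm (evalA A x P)) <= eps).

Definition in_orbit_ball (n k : nat) (w : R) (B T : nat -> mat) : Prop :=
  exists W, unitary k W /\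
    norm2 n k (fun i => msub (T i) (mmul k (mmul k W (B i)) (madj W))) < w.

Definition o2 (n k : nat) (Sigma : (nat -> mat) -> Prop) (w : R) : Rbar :=
  Rbar_inf (fun r => exists Ls : list (nat -> mat),
     r = Fin (INR (length Ls)) /\
     (forall B, In B Ls -> Sigma B) /\
     (forall T, Sigma T -> exists B, In B Ls /\ in_orbit_ball n k w B T)).

Definition Ktop_omega (A : CStarAlgebra) (x : nat -> A) (m : nat) (w : R) : Rbar :=
  Rbar_sup (fun s => exists Rr, 0 < Rr /\ s =
    Rbar_inf (fun t => exists eps L, 0 < eps /\ Forall (vars_lt m) L /\ t =
      limsup_seq (fun k => Rbar_log_div (o2 m k (Gamma_top A x m Rr k eps L) w) k))).

Definition Ktop (A : CStarAlgebra) (x : nat -> A) (m : nat) : Rbar :=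
  limsup_0plus (fun w => Ktop_omega A x m w).

(* Main.v *)
Require Import Defs.
From Stdlib Require Import Reals QArith List.
From Stdlib Require ClassicalEpsilon.
From HB Require structures.
From mathcomp Require all_boot all_order all_algebra complex ring lra zify boolp Rstruct.
Open Scope R_scope.

(** Write [e_ab] for the matrix units of [B = M_n(A)].  Polynomials in [y]
    approximate [e_a0], [e_0a] and [x_i (x) 1], so a good microstate [T] of [y] of
    size [K] yields matrices [F_a] that almost satisfy the relations of [e_a0].
    Perturbing them by means of the spectral theorem gives exact isometries [U_a]
    from [C^k] to [C^K] with orthogonal ranges summing up to [C^K].  Hence
    [K = n k], and the compression by [U_0] of the matrices approximating
    [x_i (x) 1] is a microstate [a] of [x] of size [k]; it determines [T] up to a
    small error, because [y_j = sum_ab e_a0 (S_jab(x) (x) 1) e_0b] approximately.  A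
    covering of the microstates of [x] thus induces one of the microstates of [y]
    with at most as many orbit balls, and dividing its logarithm by [(n k)^2]
    instead of [k^2] only makes it smaller.

    That [a |-> a (x) 1] is isometric is not part of the hypotheses.  It holds
    since a self-adjoint [h] with [|h| < 1] is the real part of the unitary
    [h + i sqrt (1 - h^2)], a property that is transported both ways. *)

(** The perturbations are made in operator norm, with constants that depend on n, the x_i and the
    chosen polynomials but never on the size K. Hilbert-Schmidt estimates of microstates appear only
    when two of them are compared, and there [tau] cancels the factor sqrt K. The order of choices
    is delicate. For a radius w on the y side the polynomials S_jab are fixed first; their Lipschitz
    constants tell how small the radius w' on the x side must be; only then is (eps', L') for x
    given and (eps, L) for y constructed. One norm cutoff for x, depending on x alone, serves all
    cutoffs for y, because L controls the norms of the approximants of x_i (x) 1. The isometries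
    depend on T. Microstates T and T' whose a and a' lie in one orbit ball are compared through the
    unitary sum_s U_s V U'_s^*, where V moves a' close to a; this is where orbit balls, rather than
    norm balls, are used. Centres must lie in the covered set, so each ball yields one microstate of
    y that it catches, at the price of doubling w'. If n does not divide K, there are no good
    microstates, and log 0 = -oo disposes of K. *)

(* The module confines MathComp's notations, which would change the meaning of
   [<=] in the statement of the theorem. *)
Module TensorMatrix.

Import HB.structures ClassicalEpsilon.
From mathcomp Require Import all_boot all_order all_algebra.
From mathcomp Require Import complex ring lra zify boolp Rstruct.
Set Implicit Arguments. Unset Strict Implicit. Unset Printing Implicit Defensive.
Import Order.TTheory GRing.Theory Num.Theory.
Local Open Scope ring_scope.
Local Open Scope sesquilinear_scope.

(** * Hilbert-Schmidt and operator norm bounds for complex matrices *)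

Section Bounds.
Variable R : rcfType.
Local Notation C := R[i].

Definition nsq (z : C) : R := complex.Re z ^+ 2 + complex.Im z ^+ 2.

Lemma nsq_ge0 z : 0 <= nsq z.
Proof. by rewrite addr_ge0 ?sqr_ge0. Qed.

Lemma nsqE z : (nsq z)%:C%C = z^* * z.
Proof. by rewrite add_Re2_Im2 sqr_normc mulrC. Qed.

Lemma nsqM z w : nsq (z * w) = nsq z * nsq w.
Proof. by case: z w => [a b] [c d]; rewrite /nsq /=; ring. Qed.

Lemma nsq_conj z : nsq z^* = nsq z.
Proof. by case: z => a b; rewrite /nsq /= sqrrN. Qed.

Lemma nsq0 : nsq 0 = 0.
Proof. by rewrite /nsq /= expr0n addr0. Qed.

Lemma nsq1 : nsq 1 = 1.
Proof. by rewrite /nsq /= expr0n expr1n addr0. Qed.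

Lemma nsqN z : nsq (- z) = nsq z.
Proof. by case: z => a b; rewrite /nsq /= !sqrrN. Qed.

Lemma nsq_real (x : R) : nsq x%:C%C = x ^+ 2.
Proof. by rewrite /nsq /= expr0n addr0. Qed.

Lemma nsq_eq0 z : nsq z = 0 -> z = 0.
Proof.
move=> h; have /eqP := nsqE z; rewrite h eq_sym mulf_eq0.
by case/orP; rewrite ?conjC_eq0 => /eqP.
Qed.

(* With [a] and [b] bounds for the norms of [z] and [w], summing this over the
   entries gives the triangle inequality without Cauchy-Schwarz. *)
Lemma nsqD a b z w : 0 < a -> 0 < b ->
  nsq (z + w) <= (1 + b / a) * nsq z + (1 + a / b) * nsq w.
Proof.
move=> a0 b0; case: z w => [x y] [u v]; rewrite /nsq /= -subr_ge0.
suff -> : (1 + b / a) * (x ^+ 2 + y ^+ 2) + (1 + a / b) * (u ^+ 2 + v ^+ 2) -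
  ((x + u) ^+ 2 + (y + v) ^+ 2) = (b / a) * (x - a / b * u) ^+ 2
   + (b / a) * (y - a / b * v) ^+ 2.
  by rewrite addr_ge0 // mulr_ge0 ?sqr_ge0 // divr_ge0 // ltW.
by field; rewrite !gt_eqF.
Qed.

Definition fro2 m n (M : 'M[C]_(m, n)) : R := \sum_i \sum_j nsq (M i j).

Lemma fro2_ge0 m n (M : 'M[C]_(m, n)) : 0 <= fro2 M.
Proof. by rewrite sumr_ge0 // => i _; rewrite sumr_ge0 // => j _; exact: nsq_ge0. Qed.

Lemma fro2_eq0 m n (M : 'M[C]_(m, n)) : fro2 M = 0 -> M = 0.
Proof.
move=> /eqP; rewrite psumr_eq0 => [/allP h|i _]; last first.
  by rewrite sumr_ge0 // => j _; exact: nsq_ge0.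
apply/matrixP => i j; rewrite mxE; apply: nsq_eq0.
have := h i (mem_index_enum _); rewrite /= psumr_eq0 => [/allP hi|? _]; last exact: nsq_ge0.
by apply/eqP; exact: (hi j (mem_index_enum _)).
Qed.

Lemma fro20 m n : fro2 (0 : 'M[C]_(m, n)) = 0.
Proof. by rewrite /fro2 big1 // => i _; rewrite big1 // => j _; rewrite mxE nsq0. Qed.

Lemma fro2N m n (M : 'M[C]_(m, n)) : fro2 (- M) = fro2 M.
Proof. by apply: eq_bigr => i _; apply: eq_bigr => j _; rewrite mxE nsqN. Qed.

Lemma fro2_adj m n (M : 'M[C]_(m, n)) : fro2 (M^t*) = fro2 M.
Proof.
rewrite /fro2 exchange_big; apply: eq_bigr => i _; apply: eq_bigr => j _.
by rewrite !mxE nsq_conj.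
Qed.

Lemma fro2E m n (M : 'M[C]_(m, n)) : (fro2 M)%:C%C = \tr (M^t* *m M).
Proof.
rewrite /fro2 exchange_big /= raddf_sum; apply: eq_bigr => j _.
rewrite [LHS]raddf_sum mxE; apply: eq_bigr => i _.
by rewrite -[LHS]/((nsq (M i j))%:C%C) nsqE !mxE.
Qed.

Lemma fro2_col m n (M : 'M[C]_(m, n)) : fro2 M = \sum_j fro2 (col j M).
Proof.
rewrite /fro2 exchange_big; apply: eq_bigr => j _; apply: eq_bigr => i _.
by rewrite big_ord1 mxE.
Qed.

Lemma fro21 n : fro2 (1%:M : 'M[C]_n) = n%:R.
Proof.
rewrite -[n in RHS]card_ord -sumr_const; apply: eq_bigr => i _.
rewrite (bigD1 i) //= mxE eqxx nsq1 big1 ?addr0 // => j ji.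
by rewrite mxE eq_sym (negbTE ji) nsq0.
Qed.

Lemma fro2Z m n (z : C) (M : 'M[C]_(m, n)) : fro2 (z *: M) = nsq z * fro2 M.
Proof.
rewrite /fro2 mulr_sumr; apply: eq_bigr => i _; rewrite mulr_sumr.
by apply: eq_bigr => j _; rewrite mxE nsqM.
Qed.

Lemma adjM m n p (M : 'M[C]_(m, n)) (N : 'M[C]_(n, p)) :
  (M *m N)^t* = N^t* *m M^t*.
Proof. by rewrite trmx_mul map_mxM. Qed.

Lemma adjD m n (M N : 'M[C]_(m, n)) : (M + N)^t* = M^t* + N^t*.
Proof. by rewrite linearD map_mxD. Qed.

Lemma adjN m n (M : 'M[C]_(m, n)) : (- M)^t* = - M^t*.
Proof. by rewrite linearN map_mxN. Qed.

Lemma adj1 n : (1%:M : 'M[C]_n)^t* = 1%:M.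
Proof. by rewrite trmx1 map_mx1. Qed.

Lemma adj0 m n : (0 : 'M[C]_(m, n))^t* = 0.
Proof. by rewrite trmx0 map_mx0. Qed.

Lemma adj_sum m n (I : Type) (r : seq I) (P : pred I) (F : I -> 'M[C]_(m, n)) :
  (\sum_(i <- r | P i) F i)^t* = \sum_(i <- r | P i) (F i)^t*.
Proof. by rewrite (big_morph _ (@adjD m n) (@adj0 m n)). Qed.

(** Norms are used only through bounds with explicit constants, so [frob] and [opb] are predicates
    and no supremum has to be formed. *)
Definition frob (c : R) m n (M : 'M[C]_(m, n)) := 0 <= c /\ fro2 M <= c ^+ 2.

Lemma frob_le c d m n (M : 'M[C]_(m, n)) : c <= d -> frob c M -> frob d M.
Proof.
move=> cd [c0 h]; have d0 := le_trans c0 cd.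
by split=> //; apply: le_trans h _; rewrite ler_sqr ?nnegrE.
Qed.

Lemma frobN c m n (M : 'M[C]_(m, n)) : frob c M -> frob c (- M).
Proof. by case=> c0 h; split; rewrite ?fro2N. Qed.

Lemma frob0 m n : frob 0 (0 : 'M[C]_(m, n)).
Proof. by split; rewrite ?fro20 ?expr0n. Qed.

Lemma frobD c d m n (M N : 'M[C]_(m, n)) : frob c M -> frob d N -> frob (c + d) (M + N).
Proof.
case=> c0 hM [d0 hN]; split; first exact: addr_ge0.
(* [nsqD] divides by both bounds, so zero bounds, which force the matrix to vanish, are treated
   apart. *)
have [c_eq0|cn] := eqVneq c 0.
  have -> : M = 0.
    by apply/fro2_eq0/eqP; rewrite eq_le fro2_ge0 andbT (le_trans hM) // c_eq0 expr0n.
  by rewrite c_eq0 !add0r.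
have [d_eq0|dn] := eqVneq d 0.
  have -> : N = 0.
    by apply/fro2_eq0/eqP; rewrite eq_le fro2_ge0 andbT (le_trans hN) // d_eq0 expr0n.
  by rewrite d_eq0 !addr0.
have {}c0 : 0 < c by rewrite lt_neqAle eq_sym cn.
have {}d0 : 0 < d by rewrite lt_neqAle eq_sym dn.
apply: (@le_trans _ _ ((1 + d / c) * fro2 M + (1 + c / d) * fro2 N)).
  rewrite /fro2 !mulr_sumr -big_split /=; apply: ler_sum => i _.
  rewrite !mulr_sumr -big_split /=; apply: ler_sum => j _.
  by rewrite mxE; apply: nsqD.
have -> : (c + d) ^+ 2 = (1 + d / c) * c ^+ 2 + (1 + c / d) * d ^+ 2.
  by field; rewrite !gt_eqF.
by apply: lerD; rewrite ler_wpM2l // addr_ge0 // divr_ge0 // ltW.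
Qed.

Lemma frobB c d m n (M N : 'M[C]_(m, n)) : frob c M -> frob d N -> frob (c + d) (M - N).
Proof. by move=> ? /frobN; apply: frobD. Qed.

Lemma frob_adj c m n (M : 'M[C]_(m, n)) : frob c M -> frob c (M^t*).
Proof. by case=> ? ?; split; rewrite ?fro2_adj. Qed.

(** Testing on matrices with any number of columns makes the product rules immediate; [opb_col]
    reduces this to vectors. *)
Definition opb (c : R) m n (M : 'M[C]_(m, n)) :=
  0 <= c /\ forall p (N : 'M[C]_(n, p)), fro2 (M *m N) <= c ^+ 2 * fro2 N.

Lemma opb_col c m n (M : 'M[C]_(m, n)) : 0 <= c ->
  (forall v : 'cV_n, fro2 (M *m v) <= c ^+ 2 * fro2 v) -> opb c M.
Proof.
move=> c0 h; split=> // p N; rewrite (fro2_col (M *m N)) (fro2_col N) mulr_sumr.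
by apply: ler_sum => j _; rewrite colE -mulmxA -colE; apply: h.
Qed.

Lemma frob_opl c d m n p (M : 'M[C]_(m, n)) (N : 'M_(n, p)) :
  opb c M -> frob d N -> frob (c * d) (M *m N).
Proof.
case=> c0 hM [d0 hN]; split; first exact: mulr_ge0.
by apply: le_trans (hM _ N) _; rewrite exprMn ler_wpM2l ?exprn_ge0.
Qed.

Lemma opbP c m n (M : 'M[C]_(m, n)) : opb c M <-> (0 <= c /\
  forall p d (N : 'M[C]_(n, p)), frob d N -> frob (c * d) (M *m N)).
Proof.
split=> [h|[c0 h]]; first by split; [case: h|move=> p d N; apply: frob_opl].
split=> // p N; have s0 := sqrtr_ge0 (fro2 N).
have [|_] := h p (Num.sqrt (fro2 N)) N; first by split; rewrite ?sqr_sqrtr ?fro2_ge0.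
by rewrite exprMn sqr_sqrtr ?fro2_ge0.
Qed.

Lemma opb_ge0 c m n (M : 'M[C]_(m, n)) : opb c M -> 0 <= c. Proof. by case. Qed.

Lemma opb_le c d m n (M : 'M[C]_(m, n)) : c <= d -> opb c M -> opb d M.
Proof.
move=> cd /opbP [c0 h]; apply/opbP; split=> [|p e N hN]; first exact: le_trans cd.
by apply: frob_le (h _ _ _ hN); rewrite ler_wpM2r //; case: hN.
Qed.

Lemma opbD c d m n (M N : 'M[C]_(m, n)) : opb c M -> opb d N -> opb (c + d) (M + N).
Proof.
move=> /opbP [c0 hM] /opbP [d0 hN]; apply/opbP; split=> [|p e X hX]; first exact: addr_ge0.
by rewrite mulmxDl mulrDl; apply: frobD; [apply: hM|apply: hN].
Qed.

Lemma opbN c m n (M : 'M[C]_(m, n)) : opb c M -> opb c (- M).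
Proof.
move=> /opbP [c0 hM]; apply/opbP; split=> // p e X hX.
by rewrite mulNmx; apply: frobN; apply: hM.
Qed.

Lemma opbB c d m n (M N : 'M[C]_(m, n)) : opb c M -> opb d N -> opb (c + d) (M - N).
Proof. by move=> ? /opbN; apply: opbD. Qed.

Lemma opbM c d m n p (M : 'M[C]_(m, n)) (N : 'M[C]_(n, p)) :
  opb c M -> opb d N -> opb (c * d) (M *m N).
Proof.
move=> /opbP [c0 hM] /opbP [d0 hN]; apply/opbP; split=> [|q e X hX]; first exact: mulr_ge0.
by rewrite -mulmxA -mulrA; apply/hM/hN.
Qed.

Lemma opb0 m n : opb 0 (0 : 'M[C]_(m, n)).
Proof. by split=> // p N; rewrite mul0mx fro20 expr0n mul0r. Qed.

Lemma opb_sum c m n k (F : 'I_k -> 'M[C]_(m, n)) :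
  (forall i, opb c (F i)) -> opb (k%:R * c) (\sum_i F i).
Proof.
move=> h; have -> : k%:R * c = \sum_(i < k) c by rewrite sumr_const card_ord mulr_natl.
by apply: (big_ind2 (fun x M => opb x M)) => [|*|i _]; [exact: opb0|exact: opbD|exact: h].
Qed.

Lemma frob_sum c m n k (F : 'I_k -> 'M[C]_(m, n)) :
  (forall i, frob c (F i)) -> frob (k%:R * c) (\sum_i F i).
Proof.
move=> h; have -> : k%:R * c = \sum_(i < k) c by rewrite sumr_const card_ord mulr_natl.
by apply: (big_ind2 (fun x M => frob x M)) => [|*|i _]; [exact: frob0|exact: frobD|exact: h].
Qed.

Lemma opb_scalar n (z : C) : opb (Num.sqrt (nsq z)) (z%:M : 'M[C]_n).
Proof.
split=> [|p N]; first exact: sqrtr_ge0.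
by rewrite mul_scalar_mx fro2Z sqr_sqrtr ?nsq_ge0.
Qed.

Lemma opb_isom m n (J : 'M[C]_(m, n)) : J^t* *m J = 1%:M -> opb 1 J.
Proof.
move=> hJ; split=> // p N; rewrite expr1n mul1r.
suff: (fro2 (J *m N))%:C%C = (fro2 N)%:C%C :> C by case=> ->.
by rewrite !fro2E adjM -mulmxA (mulmxA (J^t*)) hJ mul1mx.
Qed.

Lemma opb1 n : opb 1 (1%:M : 'M[C]_n).
Proof. by apply: opb_isom; rewrite adj1 mul1mx. Qed.

Lemma fro2_subr_scale m n (c : R) (V W : 'M[C]_(m, n)) :
  fro2 (c%:C%C *: V - W) =
    c ^+ 2 * fro2 V - 2 * c * complex.Re (\tr (V^t* *m W)) + fro2 W.
Proof.
have -> : complex.Re (\tr (V^t* *m W)) = \sum_i \sum_j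
   (complex.Re (V i j) * complex.Re (W i j) + complex.Im (V i j) * complex.Im (W i j)).
  rewrite [RHS]exchange_big /mxtrace (big_morph (@complex.Re R) (id1 := 0) (op1 := +%R)) //; last by case=> ? ? [].
  apply: eq_bigr => j _; rewrite mxE (big_morph (@complex.Re R) (id1 := 0) (op1 := +%R)) //; last by case=> ? ? [].
  by apply: eq_bigr => i _; rewrite !mxE; case: (V i j) (W i j) => [a b] [x y] /=; ring.
rewrite /fro2 !mulr_sumr -sumrB -big_split /=; apply: eq_bigr => i _.
rewrite !mulr_sumr -sumrB -big_split /=; apply: eq_bigr => j _.
by rewrite !mxE /nsq; case: (V i j) (W i j) => [a b] [x y] /=; ring.
Qed.

(* For [Z = M^t* N] and [W = M Z], expand [0 <= |c^2 N - W|^2], where the cross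
   term is [|Z|^2] and [|W|^2 <= c^2 |Z|^2]. *)
Lemma opb_adj c m n (M : 'M[C]_(m, n)) : opb c M -> opb c (M^t*).
Proof.
case=> c0 hM; split=> // p N; set Z := M^t* *m N; set W := M *m Z.
have hW : fro2 W <= c ^+ 2 * fro2 Z by apply: hM.
have hZ : complex.Re (\tr (N^t* *m W)) = fro2 Z.
  rewrite /W mulmxA; have -> : N^t* *m M = Z^t* by rewrite adjM trmxCK.
  by rewrite -fro2E.
have [c_eq0|cn] := eqVneq c 0.
  have W0 : W = 0.
    by apply/fro2_eq0/eqP; rewrite eq_le fro2_ge0 andbT (le_trans hW) // c_eq0 expr0n mul0r.
  by rewrite -hZ W0 mulmx0 raddf0 c_eq0 expr0n mul0r.
have := fro2_ge0 ((c ^+ 2)%:C%C *: N - W); rewrite fro2_subr_scale hZ => h.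
have c20 : 0 < c ^+ 2 by rewrite exprn_gt0 // lt_neqAle eq_sym cn.
rewrite -(ler_pM2l c20) mulrA -expr2; lra.
Qed.

Lemma frob_opr c d m n p (M : 'M[C]_(m, n)) (N : 'M_(n, p)) :
  frob c M -> opb d N -> frob (c * d) (M *m N).
Proof.
move=> hM hN; rewrite -[M *m N]trmxCK adjM; apply: frob_adj; rewrite mulrC.
by apply: frob_opl; [apply: opb_adj|apply: frob_adj].
Qed.

(** The factor is the Hilbert-Schmidt norm of the identity. The normalisation of [tau] cancels it,
    so operator norm errors give dimension-free errors in [norm2]. *)
Lemma opb_frob c n (M : 'M[C]_n) : opb c M -> frob (c * Num.sqrt n%:R) M.
Proof.
move=> hM; rewrite -[M]mulmx1; apply: frob_opl => //.
by split; rewrite ?sqrtr_ge0 // fro21 sqr_sqrtr.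
Qed.

End Bounds.

(** * Approximate matrix units *)

Section MatrixUnits.
Variable R : rcfType.
Local Notation C := R[i].

Definition rdiag n (l : 'I_n -> R) : 'M[C]_n := diag_mx (\row_i (l i)%:C%C).

Lemma hermitian_diag n (F : 'M[C]_n) : F^t* = F ->
  exists U : 'M[C]_n, exists l : 'I_n -> R,
  [/\ U^t* *m U = 1%:M, U *m U^t* = 1%:M & F = U^t* *m rdiag l *m U].
Proof.
move=> hF.
have Fh : F \is hermsymmx by apply/is_hermitianmxP; rewrite expr0 scale1r hF.
have Un := spectral_unitarymx F.
have UU : spectralmx F *m (spectralmx F)^t* = 1%:M by apply/unitarymxP.
exists (spectralmx F), (fun i => complex.Re (spectral_diag F 0 i)).
split=> //; first exact: mulmx1C UU.
have /orthomx_spectralP := hermitian_normalmx Fh; rewrite (invmx_unitary Un) => {1}->.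
suff -> : diag_mx (spectral_diag F) = rdiag (fun i => complex.Re (spectral_diag F 0 i)).
  by [].
congr diag_mx; apply/rowP => i; rewrite mxE RRe_real //.
exact: (mxOverP (hermitian_spectral_diag_real Fh)).
Qed.

Lemma rdiag_mul n (l l' : 'I_n -> R) : rdiag l *m rdiag l' = rdiag (fun i => l i * l' i).
Proof.
apply/matrixP => i j; rewrite mul_diag_mx !mxE.
by case: (i == j); rewrite ?mulr1n ?mulr0n ?mulr0 // rmorphM.
Qed.

Lemma rdiagB n (l l' : 'I_n -> R) : rdiag l - rdiag l' = rdiag (fun i => l i - l' i).
Proof.
apply/matrixP => i j; rewrite !mxE.
by case: (i == j); rewrite ?mulr1n ?mulr0n ?subr0 // rmorphB.
Qed.

Lemma rdiag1 n : rdiag (fun _ => 1) = 1%:M :> 'M[C]_n.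
Proof. by apply/matrixP => i j; rewrite !mxE. Qed.

Lemma rdiag_adj n (l : 'I_n -> R) : (rdiag l)^t* = rdiag l.
Proof.
apply/matrixP => i j; rewrite !mxE eq_sym.
case: eqP => [->|_]; rewrite ?mulr1n ?mulr0n ?conjC0 //.
exact: conjc_real.
Qed.

Lemma rdiag_ext n (l l' : 'I_n -> R) : l =1 l' -> rdiag l = rdiag l'.
Proof. by move=> h; congr diag_mx; apply/rowP => i; rewrite !mxE h. Qed.

(** Together with [opb_conj_unitary] this reduces norm estimates for functions of one Hermitian
    matrix to scalar inequalities on its eigenvalues. *)
Lemma opb_rdiag c n (l : 'I_n -> R) : 0 <= c ->
  opb c (rdiag l) <-> (forall i, `|l i| <= c).
Proof.
move=> c0; split=> [[_ h] i|h].
  have := h _ (delta_mx i 0 : 'cV_n).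
  rewrite /fro2 (bigD1 i) //= [X in _ <= _ * X](bigD1 i) //= !big_ord1 mul_diag_mx.
  rewrite [X in _ + X <= _]big1 => [|j ji]; last first.
    by rewrite big_ord1 !mxE (negbTE ji) mulr0 nsq0.
  rewrite [X in _ <= _ * (_ + X)]big1 => [|j ji]; last first.
    by rewrite big_ord1 mxE (negbTE ji) nsq0.
  rewrite !mxE !eqxx mulr1 nsq1 nsq_real !addr0 mulr1.
  by rewrite -real_normK ?num_real // ler_sqr ?nnegrE.
split=> // p N; rewrite /fro2 mulr_sumr; apply: ler_sum => i _.
rewrite mulr_sumr; apply: ler_sum => j _; rewrite mul_diag_mx !mxE nsqM nsq_real.
by rewrite ler_wpM2r ?nsq_ge0 // -real_normK ?num_real // ler_sqr ?nnegrE.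
Qed.

Lemma opb_conj_unitary c n (U D : 'M[C]_n) : U^t* *m U = 1%:M -> U *m U^t* = 1%:M ->
  opb c (U^t* *m D *m U) <-> opb c D.
Proof.
move=> h1 h2; have u1 : opb 1 U by apply: opb_isom.
have u2 := opb_adj u1; rewrite -[c]mul1r -[1 * c]mulr1; split=> h; last first.
  by apply: opbM => //; apply: opbM => //; rewrite mul1r mulr1 in h.
have -> : D = U *m (U^t* *m D *m U) *m U^t*.
  by rewrite !mulmxA h2 mul1mx -mulmxA h2 mulmx1.
by apply: opbM => //; apply: opbM => //; rewrite mul1r mulr1 in h.
Qed.

Lemma rdiag_conj_mul n (U : 'M[C]_n) (l l' : 'I_n -> R) : U *m U^t* = 1%:M ->
  (U^t* *m rdiag l *m U) *m (U^t* *m rdiag l' *m U) =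
  U^t* *m rdiag (fun i => l i * l' i) *m U.
Proof.
by move=> h; rewrite -rdiag_mul !mulmxA -(mulmxA _ U) h mulmx1.
Qed.

(** Cut the spectrum at 1/2. In l^2 - l = l (l - 1) the factor farther from 0 has modulus at least
    1/2, so the other is at most 2 d. The columns of [J] are the eigenvectors above the cut. *)
Lemma proj_near n d (F : 'M[C]_n) : F^t* = F -> opb d (F *m F - F) ->
  exists k, exists J : 'M[C]_(n, k),
    J^t* *m J = 1%:M /\ opb (2 * d) (J *m J^t* - F).
Proof.
move=> /hermitian_diag [U [l [h1 h2 ->]]]; rewrite rdiag_conj_mul // => h.
have d0 := opb_ge0 h.
have {}h i : `|l i * l i - l i| <= d.
  move: h; rewrite -mulmxBl -mulmxBr opb_conj_unitary // rdiagB.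
  by move/opb_rdiag; apply.
pose I := [set i | 2^-1 < l i].
pose E : 'M[C]_(n, #|I|) := \matrix_(a, b) (a == enum_val b)%:R.
have EE : E^t* *m E = 1%:M.
  apply/matrixP => a b; rewrite !mxE (bigD1 (enum_val a)) //= !mxE eqxx conjC1 mul1r.
  rewrite (inj_eq enum_val_inj) big1 ?addr0 // => i /negbTE ia.
  by rewrite !mxE ia conjC0 mul0r.
have EEt : E *m E^t* = rdiag (fun i => (i \in I)%:R).
  apply/matrixP => a b; rewrite !mxE.
  have [aI|aI] := boolP (a \in I); last first.
    rewrite rmorph0 mul0rn big1 // => c _; rewrite !mxE.
    case: eqP => [ac|]; rewrite ?mul0r //.
    by move: (enum_valP c); rewrite -ac (negbTE aI).
  rewrite rmorph1 (bigD1 (enum_rank_in aI a)) //= !mxE enum_rankK_in // eqxx mul1r.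
  rewrite conjC_nat big1 ?addr0 => [|c ca]; first by rewrite eq_sym.
  rewrite !mxE; case: eqP => [ac|]; rewrite ?mul0r //.
  by case/eqP: ca; apply: enum_val_inj; rewrite enum_rankK_in.
exists #|I|, (U^t* *m E); rewrite adjM trmxCK; split.
  by rewrite !mulmxA -(mulmxA _ U) h2 mulmx1.
rewrite mulmxA -(mulmxA _ E) EEt -mulmxBl -mulmxBr opb_conj_unitary // rdiagB.
apply/opb_rdiag; first by rewrite mulr_ge0.
move=> i; have := h i; rewrite inE ler_norml => /andP [ha hb]; rewrite ler_norml.
by case: ltP => li /=; apply/andP; split; nra.
Qed.

(** With r = sqrt l one has 1/r - 1 = (1 - l) / (r (r + 1)), and r (r + 1) = l + r is at least 1
    because l >= 1/2; hence the bound [t] is kept without loss. *)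
Lemma invsqrt_near n t (P : 'M[C]_n) : P^t* = P -> opb t (P - 1%:M) -> t <= 2^-1 ->
  exists S : 'M[C]_n, [/\ S^t* = S, S *m P *m S = 1%:M & opb t (S - 1%:M)].
Proof.
have aux (x y : R) : 0 <= x -> 2^-1 <= y -> x * x = y -> 2^-1 < x.
  by move=> ? ? ?; rewrite ltNge; apply/negP => ?; nra.
move=> /hermitian_diag [U [l [h1 h2 ->]]] h t2; have t0 := opb_ge0 h.
have e1 : 1%:M = U^t* *m rdiag (fun _ => 1) *m U by rewrite rdiag1 mulmx1.
have {}h i : `|l i - 1| <= t.
  move: h; rewrite [in X in _ - X]e1 -mulmxBl -mulmxBr opb_conj_unitary // rdiagB.
  by move/opb_rdiag; apply.
have l_gt i : 2^-1 <= l i by have := h i; rewrite ler_norml => /andP [? ?]; lra.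
pose r i : R := Num.sqrt (l i).
have rr i : r i * r i = l i by rewrite -expr2 sqr_sqrtr //; have := l_gt i; lra.
have r_gt i : 2^-1 < r i := aux _ _ (sqrtr_ge0 _) (l_gt i) (rr i).
clearbody r.
have r0 i : r i != 0 by rewrite gt_eqF //; have := r_gt i; lra.
exists (U^t* *m rdiag (fun i => (r i)^-1) *m U); split.
- by rewrite !adjM trmxCK rdiag_adj mulmxA.
- rewrite (rdiag_conj_mul _ _ h2) (rdiag_conj_mul _ _ h2) [RHS]e1.
  have e : (fun i => (r i)^-1 * l i * (r i)^-1) =1 (fun _ => 1).
    by move=> i /=; rewrite -rr mulKf ?mulfV ?r0.
  by rewrite (rdiag_ext e).
rewrite [in X in _ - X]e1 -mulmxBl -mulmxBr opb_conj_unitary // rdiagB.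
apply/opb_rdiag => // i.
have r1 : r i + 1 != 0 by rewrite gt_eqF //; have := r_gt i; lra.
have -> : (r i)^-1 - 1 = (1 - l i) * (r i * (r i + 1))^-1.
  rewrite -rr; by field; rewrite ?r0 ?r1.
rewrite normrM distrC -[leRHS]mulr1; apply: ler_pM => //.
have rp : 0 < r i by have := r_gt i; lra.
have ? : 0 < r i * (r i + 1) by rewrite mulr_gt0 // addr_gt0.
rewrite gtr0_norm ?invr_gt0 // invf_le1 // mulrDr mulr1 rr.
by have := r_gt i; have := l_gt i; lra.
Qed.

Lemma opb_diffM a b x y m n p (A A' : 'M[C]_(m, n)) (B B' : 'M[C]_(n, p)) :
  opb a (A - A') -> opb b (B - B') -> opb x A -> opb y B' ->
  opb (a * y + x * b) (A *m B - A' *m B').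
Proof.
move=> hA hB hx hy.
have -> : A *m B - A' *m B' = (A - A') *m B' + A *m (B - B').
  by rewrite mulmxBl mulmxBr [RHS]addrC addrA subrK.
by apply: opbD; apply: opbM.
Qed.

(* The block matrix [D] is idempotent and has norm less than one. *)
Lemma frob_small_eq0 n k q (D : 'I_n -> 'I_n -> 'M[C]_k) :
  (forall a b, D a b = \sum_c D a c *m D c b) -> (forall a b, opb q (D a b)) ->
  n%:R * q < 1 -> forall a b, D a b = 0.
Proof.
move=> hD hq nq a b; pose g c := fro2 (D c b).
case: (Order.TotalTheory.arg_maxP g (i0 := a) (P := xpredT)) => // i _ hi.
have q0 := opb_ge0 (hq a b).
have [_] : frob (n%:R * (q * Num.sqrt (g i))) (D i b).
  rewrite hD; apply: frob_sum => c; apply: frob_opl => //; split; first exact: sqrtr_ge0.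
  by rewrite sqr_sqrtr ?fro2_ge0 //; apply: hi.
rewrite mulrA exprMn sqr_sqrtr ?fro2_ge0 // -/(g i) => h.
have gi0 : g i = 0.
  apply/eqP; rewrite eq_le fro2_ge0 andbT.
  have nq0 : 0 <= n%:R * q by rewrite mulr_ge0.
  have : (n%:R * q) ^+ 2 < 1 by rewrite expr_lt1.
  have := fro2_ge0 (D i b); rewrite -/(g i); nra.
apply: fro2_eq0; apply/eqP; rewrite eq_le fro2_ge0 andbT -gi0; exact: hi.
Qed.

Section Perturb.
Variables (n K : nat) (i0 : 'I_n) (F : 'I_n -> 'M[C]_K) (f : 'M[C]_K) (d : R).
Hypothesis fE : f = (F i0)^t* *m F i0.
Hypothesis F2 : forall a, opb 2 (F a).
Hypothesis FF : forall a b, opb d ((F a)^t* *m F b - (a == b)%:R *: f).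
Hypothesis Ff : forall a, opb d (F a *m f - F a).
Hypothesis F1 : opb d (\sum_a F a *m (F a)^t* - 1%:M).
Hypothesis dn : n%:R ^+ 2 * 1000 * d <= 1.

Lemma matrix_units : exists k, exists U : 'I_n -> 'M[C]_(K, k),
  [/\ forall a b, (U a)^t* *m U b = ((a == b)%:R)%:M,
     \sum_a U a *m (U a)^t* = 1%:M &
     forall a b, opb (246 * n%:R * d) (U a *m (U b)^t* - F a *m (F b)^t*)].
Proof.
have d0 : 0 <= d := opb_ge0 F1.
have n1 : 1 <= n%:R :> R by rewrite ler1n (leq_ltn_trans (leq0n _) (ltn_ord i0)).
have fh : f^t* = f by rewrite fE adjM trmxCK.
have ff : opb (2 * d) (f *m f - f).
  have -> : f *m f - f = (F i0)^t* *m (F i0 *m f - F i0) by rewrite mulmxBr mulmxA -fE.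
  by apply: opbM (Ff _); apply: opb_adj.
(* [V a = F a J], with [J] an isometry onto the range of a projection near [f],
   has almost orthonormal ranges; multiplying by [(sum V V^* )^(-1/2)] makes
   [sum U U^* = 1] exact, and then [1 - U^* U] is a small projection. *)
have [k [J [JJ Jf]]] := proj_near fh ff.
have J1 : opb 1 J by apply: opb_isom.
have J1' := opb_adj J1.
pose V a := F a *m J.
have V2 a : opb 2 (V a) by rewrite -[2]mulr1; apply: opbM.
have V2' a := opb_adj (V2 a).
have VV' a b : opb (18 * d) (V a *m (V b)^t* - F a *m (F b)^t*).
  have -> : V a *m (V b)^t* - F a *m (F b)^t* =
     F a *m (J *m J^t* - f) *m (F b)^t* + (F a *m f - F a) *m (F b)^t*.
    by rewrite /V adjM mulmxBr !mulmxBl !mulmxA addrA subrK.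
  have -> : 18 * d = 2 * (2 * (2 * d)) * 2 + d * 2 by ring.
  by apply: opbD; apply: opbM (opb_adj (F2 b)) => //; apply: opbM.
have VV a b : opb (5 * d) ((V a)^t* *m V b - ((a == b)%:R)%:M).
  have -> : (V a)^t* *m V b - ((a == b)%:R)%:M =
     J^t* *m ((F a)^t* *m F b - (a == b)%:R *: f) *m J -
     (a == b)%:R *: (J^t* *m (J *m J^t* - f) *m J).
    rewrite /V adjM !mulmxBr !mulmxBl !mulmxA JJ mul1mx JJ -scalemxAr -scalemxAl.
    by rewrite scalerBr -scalemx1 opprB addrA subrK.
  have -> : 5 * d = 1 * d * 1 + 1 * (2 * (2 * d)) * 1 by ring.
  apply: opbB; first by apply: opbM => //; apply: opbM.
  case: (a == b); rewrite ?scale1r ?scale0r; first by apply: opbM => //; apply: opbM.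
  by apply: opb_le (opb0 _ _ _); rewrite mul1r mulr1 !mulr_ge0.
(* Origin of the constants: n (18 d) + d <= t. Since t <= 1, the defect of [U] is at most 12 t + 5 d
   <= 233 n d and its distance to the [F] products at most 12 t + 18 d <= 246 n d. The hypothesis
   [dn] gives both t <= 1/2 and n (233 n d) < 1. *)
pose P := \sum_a V a *m (V a)^t*; pose t := 19 * n%:R * d.
have P1 : opb t (P - 1%:M).
  have -> : P - 1%:M = \sum_a (V a *m (V a)^t* - F a *m (F a)^t*) +
      (\sum_a F a *m (F a)^t* - 1%:M).
    by rewrite sumrB addrA subrK.
  apply: (@opb_le _ (n%:R * (18 * d) + d)); first by rewrite /t; nra.
  by apply: opbD => //; apply: opb_sum.
have Ph : P^t* = P by rewrite adj_sum; apply: eq_bigr => a _; rewrite adjM trmxCK.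
have n2 : n%:R <= n%:R ^+ 2 :> R by rewrite expr2 ler_peMl.
have nd : n%:R * d <= n%:R ^+ 2 * d by rewrite ler_wpM2r.
have dn' : 1000 * (n%:R ^+ 2 * d) <= 1 by move: dn; rewrite mulrAC mulrC.
have nd' : 1000 * (n%:R * d) <= 1 by apply: le_trans dn'; rewrite ler_wpM2l.
have t2 : t <= 2^-1 by rewrite /t -mulrA; move: nd'; set z := n%:R * d => nd'; lra.
have [S [Sh SPS S1]] := invsqrt_near Ph P1 t2.
have t0 := opb_ge0 S1.
have Sb : opb (1 + t) S.
  by rewrite -[S](subrK 1%:M) addrC; apply: opbD => //; apply: opb1.
pose U a := S *m V a.
have UU a b : (U a)^t* *m U b - ((a == b)%:R)%:M =
   ((V a)^t* *m ((S - 1%:M) *m S + (S - 1%:M)) *m V b) + ((V a)^t* *m V b - ((a == b)%:R)%:M).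
  have -> : (S - 1%:M) *m S + (S - 1%:M) = S *m S - 1%:M.
    by rewrite mulmxBl mul1mx addrA subrK.
  by rewrite mulmxBr mulmx1 mulmxBl addrA subrK /U adjM Sh !mulmxA.
have S2 : opb (3 * t) ((S - 1%:M) *m S + (S - 1%:M)).
  by apply: (@opb_le _ (t * (1 + t) + t)); [nra|apply: opbD => //; apply: opbM].
have UU1 : \sum_a U a *m (U a)^t* = 1%:M.
  rewrite -SPS mulmx_sumr mulmx_suml; apply: eq_bigr => a _.
  by rewrite /U adjM Sh !mulmxA.
exists k, U; split=> //.
- have q a b : opb (233 * n%:R * d) (((a == b)%:R)%:M - (U a)^t* *m U b).
    rewrite -opprB; apply: opbN; rewrite UU.
    apply: (@opb_le _ (2 * (3 * t) * 2 + 5 * d)); first by rewrite /t; nra.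
    by apply: opbD => //; apply: opbM => //; apply: opbM.
  move=> a b; apply/esym/eqP; rewrite -subr_eq0; apply/eqP.
  apply: (frob_small_eq0 _ q) => [{}a {}b|]; last first.
    have -> : n%:R * (233 * n%:R * d) = 233 * (n%:R ^+ 2 * d) by ring.
    by move: dn'; set z := n%:R ^+ 2 * d => h; lra.
  under eq_bigr => c _ do rewrite mulmxBl !mulmxBr.
  rewrite !sumrB.
  have e1 (X : 'I_n -> 'M[C]_k) : \sum_c ((a == c)%:R)%:M *m X c = X a.
    rewrite (bigD1 a) //= eqxx mul1mx big1 ?addr0 // => c /negbTE ca.
    by rewrite eq_sym ca raddf0 mul0mx.
  have e2 (X : 'I_n -> 'M[C]_k) : \sum_c X c *m ((c == b)%:R)%:M = X b.
    rewrite (bigD1 b) //= eqxx mulmx1 big1 ?addr0 // => c /negbTE cb.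
    by rewrite cb raddf0 mulmx0.
  rewrite !e1 e2; under [X in _ - (_ - X)]eq_bigr => c _.
    rewrite mulmxA -(mulmxA _ (U c)); over.
  by rewrite -mulmx_suml -mulmx_sumr UU1 mulmx1 subrr subr0.
move=> a b.
have -> : U a *m (U b)^t* - F a *m (F b)^t* =
   ((S - 1%:M) *m (V a *m (V b)^t*) *m S + V a *m (V b)^t* *m (S - 1%:M)) +
   (V a *m (V b)^t* - F a *m (F b)^t*).
  rewrite addrA; congr (_ - _).
  by rewrite mulmxBl mul1mx mulmxBl mulmxBr mulmx1 addrA subrK subrK /U adjM Sh !mulmxA.
apply: (@opb_le _ ((t * (2 * 2) * (1 + t) + 2 * 2 * t) + 18 * d)).
  by rewrite /t in t2 *; nra.
apply: opbD => //; apply: opbD; apply: opbM => //; last exact: opbM.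
by apply: opbM => //; apply: opbM.
Qed.

End Perturb.

End MatrixUnits.

Local Notation R := Rdefinitions.R.
Local Notation C := R[i].
Bind Scope ring_scope with Rdefinitions.R.

(** * C*-algebras *)

Definition chalf : Cpx := mkC (2^-1) 0.

HB.instance Definition _ (A : CStarAlgebra) := gen_eqMixin (car A).
HB.instance Definition _ (A : CStarAlgebra) := gen_choiceMixin (car A).

Section Ring.
Variable A : CStarAlgebra.

Lemma cadd_0l : left_id czero (@cadd A).
Proof. by move=> x; rewrite cadd_comm cadd_0. Qed.
Lemma cadd_oppl : left_inverse czero copp (@cadd A).
Proof. by move=> x; rewrite cadd_comm cadd_opp. Qed.

End Ring.

HB.instance Definition _ (A : CStarAlgebra) := GRing.isZmodule.Build (car A)
  (@cadd_assoc A) (@cadd_comm A) (@cadd_0l A) (@cadd_oppl A).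
(** A possibly zero ring, since the axioms of [CStarAlgebra] allow 1 = 0. *)
HB.instance Definition _ (A : CStarAlgebra) := GRing.Zmodule_isPzRing.Build (car A)
  (@cmul_assoc A) (@cmul_1l A) (@cmul_1r A) (@cmul_addl A) (@cmul_addr A).

Section CStar.
Variable A : CStarAlgebra.
Implicit Types x y z : A.

(** Scalars become central elements, so that the ring lemmas also handle [csmul]. *)
Definition al (q : Cpx) : A := csmul q 1.

Lemma csmulE q x : csmul q x = al q * x.
Proof. by rewrite /al -[x in LHS]mul1r -cmul_smull. Qed.

Lemma alC q x : al q * x = x * al q.
Proof. by rewrite -csmulE -[x in LHS]mulr1 -[LHS]cmul_smulr. Qed.

Lemma alD p q : al (Cadd p q) = al p + al q. Proof. exact: csmul_addl. Qed.
Lemma alM p q : al (Cmul p q) = al p * al q.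
Proof. by rewrite -csmulE; symmetry; apply: csmul_assoc. Qed.
Lemma al1 : al Defs.C1 = 1. Proof. exact: csmul_1. Qed.
Lemma al0 : al Defs.C0 = 0.
Proof.
apply: (addrI (al Defs.C0)); rewrite -alD addr0; congr al.
rewrite /Cadd /Defs.C0 /=; congr mkC; exact: Rplus_0_l.
Qed.
Lemma alN q : al (Copp q) = - al q.
Proof.
apply: (addrI (al q)); rewrite -alD addrN -al0; congr al.
rewrite /Cadd /Defs.C0 /=; congr mkC; exact: Rplus_opp_r.
Qed.
Lemma al_half : al chalf + al chalf = 1.
Proof.
rewrite -alD -al1 /Cadd /Defs.C1 /= !RplusE addr0; congr (al (mkC _ _)).
rewrite R1E; lra.
Qed.

Lemma starK x : cstar (cstar x) = x. Proof. exact: cstar_invol. Qed.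
Lemma starD x y : cstar (x + y) = cstar x + cstar y. Proof. exact: cstar_add. Qed.
Lemma starM x y : cstar (x * y) = cstar y * cstar x. Proof. exact: cstar_mul. Qed.
Lemma star1 : cstar 1 = 1 :> A.
Proof. by rewrite -[LHS]mul1r -{1}[1]starK -starM mul1r starK. Qed.
Lemma star_al q : cstar (al q) = al (Cconj q).
Proof. by rewrite /al cstar_smul -/(1 : A) star1. Qed.
Lemma star0 : cstar 0 = 0 :> A.
Proof. by apply: (addrI (cstar 0)); rewrite -starD !addr0. Qed.
Lemma starN x : cstar (- x) = - cstar x.
Proof. by apply: (addrI (cstar x)); rewrite -starD !addrN star0. Qed.
Lemma norm_ge0 x : 0 <= cnorm x :> R. Proof. by apply/RleP/cnorm_nonneg. Qed.
Lemma norm_eq0 x : cnorm x = 0 -> x = 0. Proof. exact: cnorm_eq0. Qed.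
Lemma normD x y : cnorm (x + y) <= cnorm x + cnorm y :> R.
Proof. by apply/RleP/cnorm_triangle. Qed.
Lemma normM x y : cnorm (x * y) <= cnorm x * cnorm y :> R.
Proof. by apply/RleP/cnorm_submult. Qed.
Lemma normS x : cnorm (cstar x * x) = cnorm x ^+ 2 :> R.
Proof. by rewrite -RpowE; apply: cnorm_cstar. Qed.
Lemma norm_csmul q x : cnorm (csmul q x) = Cabs q * cnorm x :> R.
Proof. exact: cnorm_smul. Qed.

Lemma Cabs_real (r : R) : 0 <= r -> Cabs (mkC r 0) = r.
Proof.
move=> r0; have -> : Cabs (mkC r 0) = Num.sqrt (r ^+ 2).
  by rewrite /Cabs /Cabs2 !RpowE RplusE expr0n addr0 RsqrtE.
by rewrite sqrtr_sqr ger0_norm.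
Qed.

Lemma norm_half x : cnorm (al chalf * x) = cnorm x / 2 :> R.
Proof.
rewrite -csmulE norm_csmul Cabs_real ?invr_ge0 //.
by rewrite mulrC.
Qed.

Lemma norm0 : cnorm (0 : A) = 0 :> R.
Proof.
rewrite -[0](mulr0 (al Defs.C0)) -csmulE norm_csmul (Cabs_real (r := 0)) //.
by rewrite mul0r.
Qed.

Lemma normN x : cnorm (- x) = cnorm x :> R.
Proof.
have -> : - x = csmul (Copp Defs.C1) x by rewrite csmulE alN al1 mulN1r.
rewrite norm_csmul -[RHS]mul1r; congr (_ * _).
have -> : Cabs (Copp Defs.C1) = Num.sqrt ((- 1) ^+ 2 + (- 0) ^+ 2).
  by rewrite /Cabs /Cabs2 !RpowE RsqrtE.
by rewrite sqrrN oppr0 expr0n addr0 expr1n sqrtr1.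
Qed.

Lemma norm_distC x y : cnorm (x - y) = cnorm (y - x) :> R.
Proof. by rewrite -normN opprB. Qed.

Lemma dist_triangle y x z : cnorm (x - z) <= cnorm (x - y) + cnorm (y - z) :> R.
Proof. by apply: le_trans (normD _ _); rewrite addrA subrK. Qed.

Lemma norm_star x : cnorm (cstar x) = cnorm x.
Proof.
suff h z : cnorm z <= cnorm (cstar z) :> R.
  by apply/eqP; rewrite eq_le -{2}[x]starK !h.
have := normM (cstar z) z; rewrite normS expr2.
have := norm_ge0 z; rewrite le_eqVlt => /orP [/eqP <-|z0]; first by rewrite norm_ge0.
by rewrite ler_pM2r.
Qed.

Lemma norm_isom x : cstar x * x = 1 -> cnorm x <= 1 :> R.
Proof.
have h1 : cnorm (1 : A) <= 1 :> R.
  have := normS 1; rewrite star1 mulr1 => h; have := norm_ge0 (1 : A) => h'; nra.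
by move=> hx; have := normS x; rewrite hx => h; have := norm_ge0 x => h'; nra.
Qed.

Lemma norm_le_eq0 x (c : R) : (forall e : R, 0 < e -> cnorm x <= c * e) -> x = 0.
Proof.
move=> h; apply: norm_eq0; apply/eqP; rewrite eq_le norm_ge0 andbT leNgt; apply/negP => x0.
have c0 : 0 < c.
  by rewrite ltNge; apply/negP => c0; have := h 1 ltr01; rewrite mulr1; lra.
have := h (cnorm x / (2 * c)); rewrite divr_gt0 ?mulr_gt0 // => /(_ isT).
have -> : c * (cnorm x / (2 * c)) = cnorm x / 2 by field; rewrite gt_eqF.
lra.
Qed.

Lemma complete_cvg (u : nat -> A) :
  (forall e : R, 0 < e -> exists N, forall p q, (N <= p)%N -> (N <= q)%N ->
     cnorm (u p - u q) < e) ->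
  exists l, forall e : R, 0 < e -> exists N, forall p, (N <= p)%N -> cnorm (u p - l) < e.
Proof.
move=> h; have [|l hl] := @ccomplete A u.
  move=> e /RltP /h [N hN]; exists N => p q /ssrnat.leP hp /ssrnat.leP hq; exact/RltP/hN.
by exists l => e /RltP /hl [N hN]; exists N => p /ssrnat.leP hp; apply/RltP/hN.
Qed.

Lemma geometric_cvg (u : nat -> A) (r : R) : 0 <= r < 1 ->
  (forall k, cnorm (u k.+1 - u k) <= r ^+ k) ->
  exists l, forall e : R, 0 < e -> exists N, forall p, (N <= p)%N -> cnorm (u p - l) < e.
Proof.
move=> /andP [r0 r1] hu; apply: complete_cvg => e e0.
have d0 : 0 < 1 - r by rewrite subr_gt0.
(* The telescoped geometric sum, multiplied by 1 - r to avoid a division. *)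
have hd q k : (1 - r) * cnorm (u (q + k)%N - u q) <= r ^+ q * (1 - r ^+ k).
  elim: k => [|k IH]; first by rewrite addn0 subrr norm0 expr0 subrr !mulr0.
  rewrite addnS; apply: (@le_trans _ _ ((1 - r) * (r ^+ (q + k) + cnorm (u (q + k)%N - u q)))).
    rewrite ler_pM2l //; apply: le_trans (dist_triangle (u (q + k)%N) _ _) _.
    by rewrite lerD2r hu.
  by move: IH; rewrite exprD exprS; lra.
have [N hN] : exists N, r ^+ N < (1 - r) * (e / 2).
  have e2 : 0 < (1 - r) * (e / 2) by rewrite mulr_gt0 ?divr_gt0.
  have [|N hN] := pow_lt_1_zero r _ _ (RltP e2).
    by rewrite RabsE ger0_norm //; apply/RltP.
  exists N; have /RltP := hN N (PeanoNat.Nat.le_refl N).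
  by rewrite RpowE RabsE ger0_norm ?exprn_ge0.
have hN' p : (N <= p)%N -> cnorm (u p - u N) < e / 2.
  move=> /subnKC <-; rewrite -(ltr_pM2l d0); apply: le_lt_trans (hd _ _) _.
  apply: le_lt_trans hN; rewrite -[leRHS]mulr1 ler_wpM2l ?exprn_ge0 //.
  by rewrite gerBl exprn_ge0.
exists N => p q hp hq; apply: le_lt_trans (dist_triangle (u N) _ _) _.
by rewrite (norm_distC (u N)) [e]splitr ltrD ?hN'.
Qed.

(* The square root of [1 - a] is [1 - l], where [l] is the fixed point of the
   contraction [y |-> (a + y^2) / 2] of the ball of radius [cnorm a]. *)
Lemma sqrt_one_sub (a : A) : cstar a = a -> cnorm a < 1 :> R ->
  exists g, [/\ cstar g = g, g * g = 1 - a &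
    forall z, z * a = a * z -> z * g = g * z].
Proof.
move=> ha; set r := cnorm a => r1; have r0 : 0 <= r := norm_ge0 a.
set h : A := al chalf.
pose fix y k : A := if k is k'.+1 then h * (a + y k' * y k') else 0.
have yr k : cnorm (y k) <= r :> R.
  elim: k => [|k IH] /=; first by rewrite norm0.
  rewrite norm_half; have := normD a (y k * y k); have := normM (y k) (y k).
  have := norm_ge0 (y k); rewrite -/r => *; nra.
have sq (u v : A) : h * (a + u * u) - h * (a + v * v) = h * (u * (u - v) + (u - v) * v).
  rewrite -mulrBr opprD addrACA subrr add0r; congr (_ * _).
  by rewrite mulrBr mulrBl addrA subrK.
have nsq (u v : A) : cnorm (h * (a + u * u) - h * (a + v * v)) <=
    (cnorm u + cnorm v) / 2 * cnorm (u - v).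
  rewrite sq norm_half; have := normD (u * (u - v)) ((u - v) * v).
  have := normM u (u - v); have := normM (u - v) v; lra.
have dy k : cnorm (y k.+1 - y k) <= r ^+ k.
  elim: k => [|k IH]; first by rewrite subr0 expr0 (le_trans (yr _)) // ltW.
  apply: le_trans (nsq _ _) _; rewrite exprS; apply: ler_pM => //; try exact: norm_ge0.
    by rewrite divr_ge0 // addr_ge0 // norm_ge0.
  by have := yr k; have := yr k.+1; rewrite /=; lra.
have [|l hl] := geometric_cvg (r := r) _ dy; first by rewrite r0.
have lr : cnorm l <= 1 :> R.
  have [|N /(_ N (leqnn _)) hN] := hl (1 - r); first by rewrite subr_gt0.
  have := dist_triangle (y N) l 0; have := yr N.
  by rewrite !subr0 (norm_distC l); lra.
have lE : l = h * (a + l * l).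
  apply/eqP; rewrite -subr_eq0; apply/eqP; apply: (@norm_le_eq0 _ 2) => e /hl [N hN].
  have h1 := hN N.+1 (leqnSn N); have h2 := hN N (leqnn N).
  have := dist_triangle (y N.+1) l (h * (a + l * l)); rewrite (norm_distC l (y N.+1)).
  have h3 : cnorm (y N.+1 - h * (a + l * l)) <=
    (cnorm (y N) + cnorm l) / 2 * cnorm (y N - l) := nsq _ _.
  have h4 : (cnorm (y N) + cnorm l) / 2 * cnorm (y N - l) <= 1 * cnorm (y N - l).
    by rewrite ler_wpM2r ?norm_ge0 //; have := yr N; lra.
  lra.
have ll : l + l = a + l * l.
  by rewrite {1 2}lE -mulrDl al_half mul1r.
have hstar : cstar h = h.
  by rewrite star_al /Cconj /= Ropp_0.
have ys k : cstar (y k) = y k.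
  elim: k => [|k IH] /=; first exact: star0.
  by rewrite starM starD starM IH ha hstar -alC.
exists (1 - l); split.
- rewrite starD starN star1; congr (_ - _); apply/eqP; rewrite -subr_eq0; apply/eqP.
  apply: (@norm_le_eq0 _ 2) => e /hl [N /(_ N (leqnn _)) hN].
  have := dist_triangle (y N) (cstar l) l; rewrite -{1}(ys N) -starN -starD norm_star.
  by rewrite (norm_distC l); lra.
- have aE : a = l + l - l * l by rewrite ll addrK.
  by rewrite [in RHS]aE -[l + l - _]addrA opprD addrA mulrBr mulr1 mulrBl mul1r.
(* The iterates are polynomials in [a], so whatever commutes with [a] commutes with them and with
   their limit. This clause later shows that a square root found in [B] comes from [A]. *)
move=> z hz; rewrite mulrBr mulrBl mulr1 mul1r; congr (_ - _).
have yz k : z * y k = y k * z.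
  elim: k => [|k IH] /=; first by rewrite mulr0 mul0r.
  by rewrite mulrA -alC -!mulrA mulrDr mulrDl hz mulrA IH -!mulrA IH.
apply/eqP; rewrite -subr_eq0; apply/eqP.
apply: (@norm_le_eq0 _ (2 * cnorm z)) => e /hl [N /(_ N (leqnn _)) hN].
have -> : z * l - l * z = z * (l - y N) + (y N - l) * z.
  by rewrite mulrBr mulrBl yz addrA subrK.
have := normD (z * (l - y N)) ((y N - l) * z); have := normM z (l - y N).
have := normM (y N - l) z; rewrite (norm_distC l); have := norm_ge0 z.
by nra.
Qed.

Lemma unitary_real_part (h g : A) : cstar h = h -> cstar g = g -> h * g = g * h ->
  h * h + g * g = 1 -> cnorm h <= 1 :> R.
Proof.
move=> hs gs hg h1; set i : A := al (mkC 0 1); set u := h + i * g.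
have is_ : cstar i = - i by rewrite star_al -alN /Cconj /Copp /= Ropp_0.
have ii : i * i = - 1.
  rewrite -alM -al1 -alN; congr al.
  have e1 : 0 * 0 - 1 * 1 = - 1 :> R by rewrite mul0r mul1r sub0r.
  have e2 : 0 * 1 + 1 * 0 = - 0 :> R by rewrite mul0r mulr0 addr0 oppr0.
  exact: (congr2 mkC e1 e2).
have iC x : i * x = x * i := alC _ x.
have us : cstar u = h - i * g by rewrite starD starM is_ gs hs mulrN -iC.
have /norm_isom u1 : cstar u * u = 1.
  have e1 : h * (i * g) = i * g * h by rewrite mulrA -iC -mulrA hg mulrA.
  have e2 : i * g * (i * g) = - (g * g).
    by rewrite -mulrA (mulrA g) -iC -mulrA mulrA ii mulN1r.
  by rewrite us mulrBl !mulrDr e1 e2 opprD opprK addrA addrK.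
have -> : h = al chalf * (u + cstar u).
  by rewrite us addrACA subrr addr0 mulrDr -mulrDl al_half mul1r.
by rewrite norm_half; have := normD u (cstar u); rewrite norm_star; lra.
Qed.

End CStar.

(** * The tensor product with a matrix algebra *)

Section NormComparison.
Variables A B : CStarAlgebra.

Definition rinvC (t : R) : Cpx := mkC t^-1 (GRing.zero : R).

(* [h] and [k] are elements of two algebras that correspond to each other: if
   square roots of [1 - (h/t)^2] can be carried over, then [k/t] is the real part
   of a unitary. *)
Lemma norm_le_of_sqrt (h : A) (k : B) : cstar h = h -> cstar k = k ->
  (forall t : R, 0 < t -> forall g : A,
    let h' := al A (rinvC t) * h in let k' := al B (rinvC t) * k in
    cstar g = g -> g * g = 1 - h' * h' ->
    (forall z, z * (h' * h') = h' * h' * z -> z * g = g * z) ->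
    exists g' : B, [/\ cstar g' = g', k' * g' = g' * k' & k' * k' + g' * g' = 1]) ->
  cnorm k <= cnorm h :> R.
Proof.
move=> hs ks H; rewrite leNgt; apply/negP => hk.
(* A midpoint: h/t has norm below 1, hence a square root exists, whereas k/t would have norm above
   1. *)
pose t : R := (cnorm h + cnorm k) / 2.
have h0 := norm_ge0 h; have t0 : 0 < t by rewrite /t; lra.
have ht : cnorm h < t by rewrite /t; lra.
have tk : t < cnorm k by rewrite /t; lra.
have nt (D : CStarAlgebra) (z : D) : cnorm (al D (rinvC t) * z) = t^-1 * cnorm z :> R.
  by rewrite -csmulE norm_csmul Cabs_real // invr_ge0 ltW.
have st (D : CStarAlgebra) (z : D) : cstar z = z ->
    cstar (al D (rinvC t) * z) = al D (rinvC t) * z.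
  move=> zs; rewrite starM zs star_al alC; congr (_ * al _ _).
  by rewrite /Cconj /rinvC /= RoppE oppr0.
set h' := al A (rinvC t) * h; have h's : cstar h' = h' := st _ _ hs.
have [|g [gs gg gc]] := @sqrt_one_sub A (h' * h') (etrans (starM _ _) (congr2 *%R h's h's)).
  rewrite -{1}h's normS expr_lt1 ?norm_ge0 // /h' nt.
  by rewrite mulrC ltr_pdivrMr // mul1r.
have [g' [g's kg kk]] := H t t0 g gs gg gc.
have := unitary_real_part (st _ _ ks) g's kg kk; rewrite nt.
by rewrite mulrC ler_pdivrMr // mul1r leNgt tk.
Qed.

End NormComparison.

Section Tensor.
Variables (A B : CStarAlgebra) (n : nat) (Psi : B -> nat -> nat -> A).
Hypothesis tens : is_tensor_Mn A n.+1 B Psi.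
Local Notation n' := n.+1.

Definition psi (b : B) : 'M[A]_n' := \matrix_(i, j) Psi b i j.

Let ltP' (i : 'I_n') : (i < n')%coq_nat. Proof. exact/ssrnat.ltP. Qed.

Lemma psiD b c : psi (b + c) = psi b + psi c.
Proof. by case: tens => h _; apply/matrixP => i j; rewrite !mxE h. Qed.

Lemma psiS q b : psi (csmul q b) = \matrix_(i, j) csmul q (psi b i j).
Proof. by case: tens => [_ [h _]]; apply/matrixP => i j; rewrite !mxE h. Qed.

Lemma fold_right_sum (f : nat -> A) k :
  fold_right (fun l acc => cadd acc (f l)) czero (List.seq 0 k) = \sum_(l < k) f l.
Proof.
have e s : fold_right (fun l acc => cadd acc (f l)) czero s = \sum_(l <- s) f l.
  by elim: s => [|a s IH] /=; rewrite ?big_nil // big_cons IH [RHS]addrC.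
have iotaE m : List.seq m k = iota m k by elim: k m => [|k IH] m //=; rewrite IH.
by rewrite e iotaE -(big_mkord xpredT f) /index_iota subn0.
Qed.

Lemma psiM b c : psi (b * c) = psi b *m psi c.
Proof.
case: tens => [_ [_ [h _]]]; apply/matrixP => i j; rewrite !mxE h //.
by rewrite fold_right_sum; apply: eq_bigr => l _; rewrite !mxE.
Qed.

Lemma psi_star b : psi (cstar b) = \matrix_(i, j) cstar (psi b j i).
Proof. by case: tens => [_ [_ [_ [h _]]]]; apply/matrixP => i j; rewrite !mxE h. Qed.

Lemma psi1 : psi 1 = 1%:M.
Proof.
case: tens => [_ [_ [_ [_ [h _]]]]]; apply/matrixP => i j; rewrite !mxE h //.
have -> : Nat.eqb i j = (i == j) by rewrite -[RHS]/(i == j :> nat); case: eqP => [->|/PeanoNat.Nat.eqb_neq //]; exact: PeanoNat.Nat.eqb_refl.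
by case: (i == j).
Qed.

Lemma psi_inj : injective psi.
Proof.
case: tens => [_ [_ [_ [_ [_ [h _]]]]]] b c e; apply: h => i j /ssrnat.ltP hi /ssrnat.ltP hj.
by have /matrixP /(_ (Ordinal hi) (Ordinal hj)) := e; rewrite !mxE.
Qed.

Lemma psi_surj (M : 'M[A]_n') : exists b, psi b = M.
Proof.
case: tens => [_ [_ [_ [_ [_ [_ h]]]]]].
have [b hb] := h (fun i j => M (inord i) (inord j)).
by exists b; apply/matrixP => i j; rewrite mxE hb ?inord_val.
Qed.

Definition ofmxB (M : 'M[A]_n') : B := sval (cid (psi_surj M)).
Lemma ofmxBK : cancel ofmxB psi.
Proof. by move=> M; rewrite /ofmxB; case: cid. Qed.
Lemma psi0 : psi 0 = 0.
Proof. by apply: (addrI (psi 0)); rewrite -psiD !addr0. Qed.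

Lemma psi_sum (I : Type) (r : seq I) (P : pred I) (F : I -> B) :
  psi (\sum_(i <- r | P i) F i) = \sum_(i <- r | P i) psi (F i).
Proof. exact: (big_morph _ psiD psi0). Qed.

Definition phi (a : A) : B := ofmxB a%:M.
Definition unitB (i j : 'I_n') : B := ofmxB (delta_mx i j).

Lemma phiD a b : phi (a + b) = phi a + phi b.
Proof. by apply: psi_inj; rewrite psiD !ofmxBK raddfD. Qed.
Lemma phiM a b : phi (a * b) = phi a * phi b.
Proof. by apply: psi_inj; rewrite psiM !ofmxBK scalar_mxM. Qed.
Lemma phi1 : phi 1 = 1.
Proof. by apply: psi_inj; rewrite psi1 !ofmxBK. Qed.
Lemma phi_inj : injective phi.
Proof.
move=> a b /(congr1 psi); rewrite !ofmxBK => /matrixP /(_ ord0 ord0).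
by rewrite !mxE eqxx !mulr1n.
Qed.
Lemma phiS q a : phi (csmul q a) = csmul q (phi a).
Proof.
apply: psi_inj; rewrite psiS !ofmxBK; apply/matrixP => i j; rewrite !mxE.
by case: (i == j); rewrite /= ?mulr1n ?mulr0n // csmulE mulr0.
Qed.
Lemma phi_star a : phi (cstar a) = cstar (phi a).
Proof.
apply: psi_inj; rewrite psi_star !ofmxBK; apply/matrixP => i j; rewrite !mxE eq_sym.
by case: (j == i); rewrite /= ?mulr1n ?mulr0n ?star0.
Qed.
Lemma phi_al q : phi (al A q) = al B q.
Proof. by rewrite /al phiS phi1. Qed.

Lemma unitB_mul i j k l : unitB i j * unitB k l = if j == k then unitB i l else 0.
Proof.
apply: psi_inj; rewrite psiM !ofmxBK; case: eqP => [->|/eqP jk].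
  by rewrite mul_delta_mx ofmxBK.
by rewrite mul_delta_mx_0 // psi0.
Qed.

Lemma unitB_star i j : cstar (unitB i j) = unitB j i.
Proof.
apply: psi_inj; rewrite psi_star !ofmxBK; apply/matrixP => k l; rewrite !mxE andbC.
by case: (_ && _); rewrite ?star0 ?star1.
Qed.

Lemma unitB_sum : \sum_i unitB i i = 1.
Proof.
apply: psi_inj; rewrite psi_sum psi1; apply/matrixP => i j; rewrite summxE mxE.
rewrite (bigD1 i) //= ofmxBK mxE eqxx eq_sym big1 ?addr0 // => k ki.
by rewrite ofmxBK mxE eq_sym (negbTE ki).
Qed.

Lemma phi_unitBC a i j : phi a * unitB i j = unitB i j * phi a.
Proof.
apply: psi_inj; rewrite !psiM !ofmxBK; apply/matrixP => k l; rewrite !mxE.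
rewrite (bigD1 k) //= !mxE eqxx mulr1n big1 ?addr0 => [|u uk]; last first.
  by rewrite !mxE eq_sym (negbTE uk) mulr0n mul0r.
rewrite (bigD1 l) //= !mxE eqxx mulr1n big1 ?addr0 => [|u ul]; last first.
  by rewrite !mxE (negbTE ul) mulr0n mulr0.
by case: (_ && _); rewrite ?mulr0 ?mul0r ?mulr1 ?mul1r.
Qed.

(** The extra factors [unitB ord0 ord0] reproduce the shape of [pH] and [pHs], with which [rel5]
    imitates this formula by polynomials. *)
Lemma decompB b : b = \sum_(i < n') \sum_(j < n') unitB i ord0 * unitB ord0 ord0 * phi (Psi b i j) *
   (unitB ord0 ord0 * unitB ord0 j).
Proof.
apply: psi_inj; rewrite psi_sum [LHS]matrix_sum_delta; apply: eq_bigr => i _.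
rewrite psi_sum; apply: eq_bigr => j _.
rewrite !unitB_mul eqxx -mulrA phi_unitBC mulrA unitB_mul eqxx psiM !ofmxBK.
apply/matrixP => k l; rewrite !mxE (bigD1 l) //= !mxE eqxx mulr1n.
rewrite big1 ?addr0 => [|u ul]; last by rewrite !mxE (negbTE ul) mulr0n mulr0.
by case: (_ && _); rewrite ?mulr0 ?mul0r ?mulr1 ?mul1r.
Qed.

(** Row 0 of e_0j b = b e_0j says that row j of b is its corner entry on the diagonal and zero
    elsewhere. *)
Lemma phi_commutant b : (forall i j, unitB i j * b = b * unitB i j) -> exists a, b = phi a.
Proof.
move=> h; exists (psi b ord0 ord0); apply: psi_inj; rewrite ofmxBK.
apply/matrixP => j l; have := h ord0 j => /(congr1 psi) /matrixP /(_ ord0 l).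
rewrite !psiM !ofmxBK !mxE (bigD1 j) //= !mxE !eqxx mul1r big1 ?addr0 => [|u uj]; last first.
  by rewrite !mxE (negbTE uj) andbF mul0r.
rewrite (bigD1 ord0) //= !mxE !eqxx big1 ?addr0 => [->|u u0]; last first.
  by rewrite !mxE (negbTE u0) mulr0.
by rewrite eq_sym; case: (_ == _); rewrite ?mulr1 ?mulr0.
Qed.

Lemma norm_phi_le_sa h : cstar h = h -> cnorm (phi h) <= cnorm h :> R.
Proof.
move=> hs; apply: norm_le_of_sqrt => //; first by rewrite -phi_star hs.
move=> t t0 g h' k' gs gg gc.
have ek : k' = phi h' by rewrite phiM phi_al.
clearbody h' k'.
exists (phi g); split; first by rewrite -phi_star gs.
  by rewrite ek -!phiM gc // mulrA.
by rewrite ek -!phiM gg -phiD addrC subrK phi1.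
Qed.

(** Here the square root [g] lives in [B]. It commutes with all that commutes with [h' * h'], in
    particular with the matrix units, so [phi_commutant] pulls it back to [A]. *)
Lemma norm_phi_ge_sa h : cstar h = h -> cnorm h <= cnorm (phi h) :> R.
Proof.
move=> hs; apply: norm_le_of_sqrt => //; first by rewrite -phi_star hs.
move=> t t0 g k' h' gs gg gc.
have ek : k' = phi h' by rewrite /h' phiM phi_al.
clearbody h' k'.
have [g' gE] : exists g', g = phi g'.
  apply: phi_commutant => i j; apply: gc.
  by rewrite ek -!phiM -phi_unitBC.
exists g'; split; first by apply: phi_inj; rewrite phi_star -gE.
  by apply: phi_inj; rewrite !phiM -gE -ek gc // mulrA.
by apply: phi_inj; rewrite phiD !phiM -gE gg -ek phi1 addrC subrK.
Qed.

Lemma norm_phi a : cnorm (phi a) = cnorm a :> R.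
Proof.
have sa : cstar (cstar a * a) = cstar a * a by rewrite starM starK.
apply/eqP; rewrite -(eqrXn2 (n := 2)) ?norm_ge0 // -!normS -phi_star -phiM.
by rewrite eq_le norm_phi_le_sa // norm_phi_ge_sa.
Qed.

Lemma norm_unitB i j : cnorm (unitB i j) <= 1 :> R.
Proof.
have h k : cnorm (unitB k k) <= 1 :> R.
  have := normS (unitB k k); rewrite unitB_star unitB_mul eqxx => h.
  have := norm_ge0 (unitB k k); nra.
have := normS (unitB i j); rewrite unitB_star unitB_mul eqxx => e.
have := norm_ge0 (unitB i j); have := h j; nra.
Qed.

Lemma evalA_phi (x : nat -> A) P : evalA B (fun i => phi (x i)) P = phi (evalA A x P).
Proof.
elim: P => [i|q|P IHP Q IHQ|P IHP Q IHQ] //=.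
- by rewrite phiS phi1.
- by rewrite IHP IHQ phiD.
- by rewrite IHP IHQ phiM.
Qed.

End Tensor.

(** * Noncommutative polynomials *)

Definition qint (z : BinNums.Z) : QArith_base.Q := Qmake z BinNums.xH.
Definition pzero := PConst (qint BinNums.Z0, qint BinNums.Z0).
Definition pone := PConst (qint (BinNums.Zpos BinNums.xH), qint BinNums.Z0).
Definition pneg P := PMul (PConst (qint (BinNums.Zneg BinNums.xH), qint BinNums.Z0)) P.
Definition psub P Q := PAdd P (pneg Q).
Definition psum (s : seq ncpoly) := foldr PAdd pzero s.
Fixpoint pstar P := match P with
  | PVar i => PVar i
  | PConst q => PConst (fst q, Qopp (snd q))
  | PAdd P Q => PAdd (pstar P) (pstar Q)
  | PMul P Q => PMul (pstar Q) (pstar P)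
  end.
(** The real part: on self-adjoint tuples it evaluates to a self-adjoint matrix, as microstates of
    [x] must be, and by [ev_psym] it approximates a self-adjoint element no worse than [P] does. *)
Definition psym P :=
  PMul (PConst (Qmake (BinNums.Zpos BinNums.xH) (BinNums.xO BinNums.xH), qint BinNums.Z0))
       (PAdd P (pstar P)).
Fixpoint psubst (s : nat -> ncpoly) P := match P with
  | PVar i => s i
  | PConst q => PConst q
  | PAdd P Q => PAdd (psubst s P) (psubst s Q)
  | PMul P Q => PMul (psubst s P) (psubst s Q)
  end.

Lemma Q2R_int z : Q2R (qint z) = IZR z.
Proof. by rewrite /Q2R /= Rinv_1 Rmult_1_r. Qed.

Lemma QQ2C_0 : QQ2C (qint BinNums.Z0, qint BinNums.Z0) = Defs.C0.
Proof. by rewrite /QQ2C /= !Q2R_int. Qed.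
Lemma QQ2C_1 : QQ2C (qint (BinNums.Zpos BinNums.xH), qint BinNums.Z0) = Defs.C1.
Proof. by rewrite /QQ2C /= !Q2R_int. Qed.
Lemma QQ2C_N1 : QQ2C (qint (BinNums.Zneg BinNums.xH), qint BinNums.Z0) = Copp Defs.C1.
Proof. by rewrite /QQ2C /Copp /= !Q2R_int Ropp_0. Qed.
Lemma QQ2C_half :
  QQ2C (Qmake (BinNums.Zpos BinNums.xH) (BinNums.xO BinNums.xH), qint BinNums.Z0) = chalf.
Proof.
rewrite /QQ2C /= Q2R_int /Q2R /= /chalf; congr mkC.
by rewrite Rmult_1_l RinvE.
Qed.
Lemma QQ2C_conj q : QQ2C (fst q, Qopp (snd q)) = Cconj (QQ2C q).
Proof. by rewrite /QQ2C /Cconj /= Qreals.Q2R_opp. Qed.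

Lemma vars_pstar m P : vars_lt m P -> vars_lt m (pstar P).
Proof. by elim: P => [i|q|P IHP Q IHQ|P IHP Q IHQ] //= [/IHP ? /IHQ ?]. Qed.
Lemma vars_psym m P : vars_lt m P -> vars_lt m (psym P).
Proof. by move=> h; split=> //; split=> //; apply: vars_pstar. Qed.
Lemma vars_psubst m s P : (forall i, vars_lt m (s i)) -> vars_lt m (psubst s P).
Proof. by move=> h; elim: P => [i|q|P IHP Q IHQ|P IHP Q IHQ] //=. Qed.

Section Eval.
Variables (A : CStarAlgebra) (x : nat -> A).
Local Notation ev := (evalA A x).

Lemma evC q : ev (PConst q) = al A (QQ2C q). Proof. by []. Qed.
Lemma evD P Q : ev (PAdd P Q) = ev P + ev Q. Proof. by []. Qed.
Lemma evM P Q : ev (PMul P Q) = ev P * ev Q. Proof. by []. Qed.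
Lemma ev0 : ev pzero = 0. Proof. by rewrite evC QQ2C_0 al0. Qed.
Lemma ev1 : ev pone = 1. Proof. by rewrite evC QQ2C_1 al1. Qed.
Lemma evN P : ev (pneg P) = - ev P.
Proof. by rewrite evM evC QQ2C_N1 alN al1 mulN1r. Qed.
Lemma evB P Q : ev (psub P Q) = ev P - ev Q.
Proof. by rewrite evD evN. Qed.
Lemma evsum s : ev (psum s) = \sum_(P <- s) ev P.
Proof. by elim: s => [|P s IH]; rewrite ?big_nil ?ev0 // big_cons -IH. Qed.
Lemma ev_psubst s P : ev (psubst s P) = evalA A (fun i => ev (s i)) P.
Proof. by elim: P => [i|q|P IHP Q IHQ|P IHP Q IHQ] //=; rewrite IHP IHQ. Qed.
Lemma ev_ext m (z : nat -> A) P : (forall i, (i < m)%coq_nat -> x i = z i) ->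
  vars_lt m P -> ev P = evalA A z P.
Proof.
move=> h; elim: P => [i|q|P IHP Q IHQ|P IHP Q IHQ] //=; first exact: h.
  by case=> /IHP -> /IHQ ->.
by case=> /IHP -> /IHQ ->.
Qed.
Lemma ev_pstar m P : (forall i, (i < m)%coq_nat -> cstar (x i) = x i) ->
  vars_lt m P -> ev (pstar P) = cstar (ev P).
Proof.
move=> h; elim: P => [i|q|P IHP Q IHQ|P IHP Q IHQ] /=; first by move/h.
- by move=> _; rewrite -[RHS]/(cstar (al A _)) star_al QQ2C_conj.
- by case=> /IHP -> /IHQ ->; rewrite starD.
- by case=> /IHP -> /IHQ ->; rewrite starM.
Qed.
Lemma ev_psym m P b : (forall i, (i < m)%coq_nat -> cstar (x i) = x i) ->
  vars_lt m P -> cstar b = b -> cnorm (ev (psym P) - b) <= cnorm (ev P - b) :> R.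
Proof.
move=> h hP hb; rewrite evM evC QQ2C_half evD (ev_pstar h hP).
have -> : al A chalf * (ev P + cstar (ev P)) - b =
    al A chalf * ((ev P - b) + cstar (ev P - b)).
  rewrite starD starN hb addrACA -opprD [RHS]mulrBr; congr (_ - _).
  by rewrite mulrDr -mulrDl al_half mul1r.
by rewrite norm_half; have := normD (ev P - b) (cstar (ev P - b)); rewrite norm_star; lra.
Qed.

End Eval.

Section Continuity.
Variables (A : CStarAlgebra).
Implicit Types x z : nat -> A.

Lemma evalA_continuous x P (e : R) : 0 < e -> exists d : R, 0 < d /\
  forall z, (forall i, cnorm (z i - x i) <= d) -> cnorm (evalA A z P - evalA A x P) <= e.
Proof.
elim: P e => [i|q|P IHP Q IHQ|P IHP Q IHQ] e e0.
- by exists e; split=> // z; apply.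
- by exists 1; split=> // z _; rewrite !evC subrr norm0 ltW.
- have e2 : 0 < e / 2 by rewrite divr_gt0.
  have [d [d0 hd]] := IHP _ e2; have [c [c0 hc]] := IHQ _ e2.
  exists (Num.min d c); split=> [|z hz]; first by rewrite lt_min d0.
  rewrite !evD opprD addrACA (le_trans (normD _ _)) // [e]splitr lerD //.
    by apply: hd => i; apply: le_trans (hz i) _; rewrite ge_min lexx.
  by apply: hc => i; apply: le_trans (hz i) _; rewrite ge_min lexx orbT.
set a := cnorm (evalA A x P); set b := cnorm (evalA A x Q).
have a0 : 0 <= a := norm_ge0 _; have b0 : 0 <= b := norm_ge0 _.
(* Chosen so that s <= 1 and s^2 + s (a + b) <= s (a + b + 1) <= e. *)
pose s : R := e / (a + b + 1 + e).
have D0 : 0 < a + b + 1 + e by lra.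
have s0 : 0 < s by rewrite divr_gt0.
have s1 : s <= 1 by rewrite ler_pdivrMr // mul1r; lra.
have sE : s * (a + b + 1 + e) = e by rewrite mulfVK // gt_eqF.
have [d [d0 hd]] := IHP _ s0; have [c [c0 hc]] := IHQ _ s0.
exists (Num.min d c); split=> [|z hz]; first by rewrite lt_min d0.
rewrite !evM; set p := evalA A x P; set q := evalA A x Q.
set p' := evalA A z P; set q' := evalA A z Q.
have hp : cnorm (p' - p) <= s.
  by apply: hd => i; apply: le_trans (hz i) _; rewrite ge_min lexx.
have hq : cnorm (q' - q) <= s.
  by apply: hc => i; apply: le_trans (hz i) _; rewrite ge_min lexx orbT.
have -> : p' * q' - p * q = (p' - p) * (q' - q) + ((p' - p) * q + p * (q' - q)).
  have H (D E : A) : (D + p) * (E + q) - p * q = D * E + (D * q + p * E).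
    by rewrite mulrDl !mulrDr !addrA addrK.
  by rewrite -H !subrK.
apply: le_trans (normD _ _) _; have := normD ((p' - p) * q) (p * (q' - q)).
have := normM (p' - p) (q' - q); have := normM (p' - p) q; have := normM p (q' - q).
rewrite -/a -/b; have := norm_ge0 (p' - p); have := norm_ge0 (q' - q).
have h1 : cnorm (p' - p) * cnorm (q' - q) <= s * 1.
  by apply: ler_pM; rewrite ?norm_ge0 // (le_trans hq).
have h2 : cnorm (p' - p) * b <= s * b by rewrite ler_wpM2r.
have h3 : a * cnorm (q' - q) <= a * s by rewrite ler_wpM2l.
have : 0 <= s * e by rewrite mulr_ge0 // ltW.
rewrite -/p -/q -/p' -/q' => *; nra.
Qed.

Lemma evalA_continuous_seq x (L : seq ncpoly) (e : R) : 0 < e -> exists d : R, 0 < d /\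
  forall z, (forall i, cnorm (z i - x i) <= d) ->
  forall P, In P L -> cnorm (evalA A z P - evalA A x P) <= e.
Proof.
move=> e0; elim: L => [|P L [d [d0 IH]]]; first by exists 1.
have [c [c0 hc]] := evalA_continuous x P e0.
exists (Num.min d c); split=> [|z hz Q /= [<-|hQ]]; first by rewrite lt_min d0.
  by apply: hc => i; apply: le_trans (hz i) _; rewrite ge_min lexx orbT.
by apply: IH => // i; apply: le_trans (hz i) _; rewrite ge_min lexx.
Qed.

Lemma norm_dist (a b : A) : `|cnorm a - cnorm b| <= cnorm (a - b) :> R.
Proof.
rewrite ler_norml; have := normD (a - b) b; rewrite subrK => h1.
have := normD (b - a) a; rewrite subrK (norm_distC b) => h2.
by apply/andP; split; lra.
Qed.

End Continuity.

(** * Density of the polynomials with rational coefficients *)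

Lemma Q2R_dense (r e : R) : 0 < e -> exists q, `|Q2R q - r| < e.
Proof.
move=> /RltP e0.
have [k [hk k0]] := archimed_cor1 _ e0.
pose q := Qmake (up (r * INR k)) (Pos.of_nat k).
exists q; rewrite -RabsE; apply/RltP; apply: Rle_lt_trans hk.
have kE : IZR (BinNums.Zpos (Pos.of_nat k)) = INR k.
  rewrite /IZR -INR_IPR Nat2Pos.id //; by case: (k) k0 => // /ssrnat.ltP.
have kp : Rlt 0 (INR k) by apply: lt_0_INR.
rewrite /Q2R /= kE; have [h1 h2] := archimed (r * INR k).
have ip := Rinv_0_lt_compat _ kp.
have e1 : Rmult (Rmult r (INR k)) (Rinv (INR k)) = r.
  by rewrite Rmult_assoc Rinv_r ?Rmult_1_r //; apply: Rgt_not_eq.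
set z := IZR _ in h1 h2 *.
have -> : Rmult z (Rinv (INR k)) - r = Rmult (Rminus z (Rmult r (INR k))) (Rinv (INR k)).
  by rewrite Rmult_minus_distr_r e1.
rewrite Rabs_mult (Rabs_right (Rinv _)); last exact/Rle_ge/Rlt_le.
rewrite -[X in Rle _ X]Rmult_1_l; apply: Rmult_le_compat_r; first exact: Rlt_le.
by rewrite Rabs_right //; apply: Rge_minus; apply: Rgt_ge.
Qed.

Lemma QQ2C_dense (c : Cpx) (e : R) : 0 < e ->
  exists q, Cabs (Csub (QQ2C q) c) < e.
Proof.
move=> e0; have e2 : 0 < e / 2 by rewrite divr_gt0.
have [q1 h1] := Q2R_dense (Defs.Re c) e2; have [q2 h2] := Q2R_dense (Defs.Im c) e2.
exists (q1, q2).
have -> : Cabs (Csub (QQ2C (q1, q2)) c) =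
    Num.sqrt ((Q2R q1 - Defs.Re c) ^+ 2 + (Q2R q2 - Defs.Im c) ^+ 2).
  by rewrite /Cabs /Cabs2 !RpowE RsqrtE.
set u : R := Q2R q1 - _ in h1 *; set v : R := Q2R q2 - _ in h2 *.
have hs : u ^+ 2 + v ^+ 2 < e ^+ 2.
  by move: h1 h2; rewrite !ltr_norml => /andP [? ?] /andP [? ?]; nra.
by rewrite -(ltr_sqr (sqrtr_ge0 _) (ltW e0)) sqr_sqrtr // addr_ge0 ?sqr_ge0.
Qed.

Section Density.
Variables (B : CStarAlgebra) (y : nat -> B) (p : nat).
Hypothesis ysa : forall j, (j < p)%coq_nat -> cstar (y j) = y j.
Hypothesis gen : generates B y p.

(** [generates] serves as an induction principle: the approximable elements form a closed unital
    star subalgebra containing the generators. *)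
Lemma dense b (e : R) : 0 < e -> exists P, vars_lt p P /\ cnorm (evalA B y P - b) < e.
Proof.
move: e; pattern b; apply: gen => {b}.
- by move=> e e0; exists pone; rewrite ev1 subrr norm0.
- by move=> i hi e e0; exists (PVar i); rewrite subrr norm0.
- move=> a b ha hb e e0; have e2 : 0 < e / 2 by rewrite divr_gt0.
  have [P [vP hP]] := ha _ e2; have [Q [vQ hQ]] := hb _ e2.
  exists (PAdd P Q); split=> //; rewrite evD -[cadd a b]/(a + b) opprD addrACA.
  by apply: le_lt_trans (normD _ _) _; rewrite [e]splitr ltrD.
- move=> c a ha e e0.
  pose r := cnorm a + 1; have r0 : 0 < r by rewrite ltr_wpDl ?norm_ge0.
  (* First a rational scalar close to [c] relative to the norm of [a], then a polynomial close to
     [a] relative to the modulus of that scalar. *)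
  have [q hq] := QQ2C_dense c (divr_gt0 (divr_gt0 e0 (ltr0n R 2)) r0).
  have s0 : 0 < Cabs (QQ2C q) + 1 by rewrite ltr_wpDl //; apply/RleP/sqrt_pos.
  have [P [vP hP]] := ha _ (divr_gt0 (divr_gt0 e0 (ltr0n R 2)) s0).
  exists (PMul (PConst q) P); split=> //; rewrite evM evC (csmulE c a).
  have -> : al B (QQ2C q) * evalA B y P - al B c * a =
      al B (QQ2C q) * (evalA B y P - a) + al B (Csub (QQ2C q) c) * a.
    by rewrite mulrBr /Csub alD alN mulrBl addrA subrK.
  apply: le_lt_trans (normD _ _) _; rewrite -!csmulE !norm_csmul [e]splitr.
  have Cq : 0 <= Cabs (QQ2C q) by apply/RleP/sqrt_pos.
  rewrite ltr_pdivlMr // in hP; rewrite ltr_pdivlMr // in hq.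
  have := norm_ge0 (evalA B y P - a); have := norm_ge0 a.
  have : 0 <= Cabs (Csub (QQ2C q) c) by apply/RleP/sqrt_pos.
  rewrite /r in hq; move=> *; apply: ltrD; nra.
- move=> a b ha hb e e0.
  (* Continuity of multiplication is the continuity of the polynomial X_0 X_1. *)
  have [d [d0 hd]] := evalA_continuous (fun i => if i is 0%N then a else b)
     (PMul (PVar 0) (PVar 1)) (divr_gt0 e0 (ltr0n R 2)).
  have [P [vP hP]] := ha _ d0; have [Q [vQ hQ]] := hb _ d0.
  exists (PMul P Q); split=> //.
  apply: (@le_lt_trans _ _ (e / 2)); last by lra.
  apply: (hd (fun i => if i is 0%N then evalA B y P else evalA B y Q)) => -[|i].
    exact: ltW.
  exact: ltW.
- move=> a ha e e0; have [P [vP hP]] := ha _ e0; exists (pstar P).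
  by rewrite (ev_pstar ysa vP) -starN -starD norm_star; split=> //; apply: vars_pstar.
- move=> u l hu hl e e0; have e2 : 0 < e / 2 by rewrite divr_gt0.
  have [N /(_ N (PeanoNat.Nat.le_refl N)) /RltP hN] := hl _ (RltP e2).
  have [P [vP hP]] := hu N _ e2; exists P; split=> //.
  by apply: le_lt_trans (dist_triangle (u N) _ _) _; rewrite [e]splitr ltrD.
Qed.

End Density.

(** * Polynomials in matrices and amplification *)

Definition toC (z : Cpx) : C := Complex (Defs.Re z) (Defs.Im z).

Fixpoint evalMx K (X : nat -> 'M[C]_K) (P : ncpoly) : 'M[C]_K := match P with
  | PVar i => X i
  | PConst q => (toC (QQ2C q))%:M
  | PAdd P Q => evalMx X P + evalMx X Q
  | PMul P Q => evalMx X P *m evalMx X Q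
  end.

Lemma toC0 : toC Defs.C0 = 0. Proof. by []. Qed.
Lemma toC1 : toC Defs.C1 = 1. Proof. by []. Qed.
Lemma toCN z : toC (Copp z) = - toC z. Proof. by []. Qed.
Lemma toC_conj z : toC (Cconj z) = (toC z)^*. Proof. by []. Qed.
Section EvalMx.
Variables (K : nat) (X : nat -> 'M[C]_K).
Local Notation ev := (evalMx X).

Lemma mx_ev0 : ev pzero = 0.
Proof. by rewrite /= QQ2C_0 toC0 raddf0. Qed.
Lemma mx_ev1 : ev pone = 1%:M.
Proof. by rewrite /= QQ2C_1 toC1. Qed.
Lemma mx_evN P : ev (pneg P) = - ev P.
Proof. by rewrite /= QQ2C_N1 toCN toC1 mul_scalar_mx scaleN1r. Qed.
Lemma mx_evB P Q : ev (psub P Q) = ev P - ev Q.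
Proof. by rewrite -mx_evN. Qed.
Lemma mx_evsum s : ev (psum s) = \sum_(P <- s) ev P.
Proof. by elim: s => [|P s IH]; rewrite ?big_nil ?mx_ev0 // big_cons -IH. Qed.
Lemma mx_ev_psubst s P : ev (psubst s P) = evalMx (fun i => ev (s i)) P.
Proof. by elim: P => [i|q|P IHP Q IHQ|P IHP Q IHQ] //=; rewrite IHP IHQ. Qed.
Lemma mx_ev_pstar m P : (forall i, (i < m)%coq_nat -> (X i)^t* = X i) ->
  vars_lt m P -> ev (pstar P) = (ev P)^t*.
Proof.
move=> h; elim: P => [i|q|P IHP Q IHQ|P IHP Q IHQ]; first by move/h => /= ->.
- by move=> _ /=; rewrite QQ2C_conj toC_conj tr_scalar_mx map_scalar_mx.
- by case=> /IHP hP /IHQ hQ /=; rewrite hP hQ adjD.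
- by case=> /IHP hP /IHQ hQ /=; rewrite hP hQ adjM.
Qed.
Lemma mx_ev_psym_sa m P : (forall i, (i < m)%coq_nat -> (X i)^t* = X i) ->
  vars_lt m P -> (ev (psym P))^t* = ev (psym P).
Proof.
move=> h hP; rewrite /psym /= (mx_ev_pstar h hP) adjM adjD trmxCK tr_scalar_mx.
rewrite map_scalar_mx mul_mx_scalar mul_scalar_mx addrC; congr (_ *: _).
by rewrite QQ2C_half -[LHS]/((toC chalf)^*) -toC_conj /Cconj /chalf /= RoppE oppr0.
Qed.

End EvalMx.

Definition psumn N (f : nat -> ncpoly) := psum [seq f i | i <- iota 0 N].
Lemma ev_psumn (A : CStarAlgebra) (x : nat -> A) N f :
  evalA A x (psumn N f) = \sum_(i < N) evalA A x (f i).
Proof. by rewrite evsum big_map -(big_mkord xpredT (fun i => evalA A x (f i))) /index_iota subn0. Qed.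
Lemma mx_ev_psumn K (X : nat -> 'M[C]_K) N f :
  evalMx X (psumn N f) = \sum_(i < N) evalMx X (f i).
Proof. by rewrite mx_evsum big_map -(big_mkord xpredT (fun i => evalMx X (f i))) /index_iota subn0. Qed.

(* Bound [pM r P] and Lipschitz constant [pC r P] of [P] on tuples of operators of
   norm at most [r], the same in all dimensions. *)
Fixpoint pM (r : R) P : R := match P with
  | PVar _ => r
  | PConst q => Num.sqrt (nsq (toC (QQ2C q)))
  | PAdd P Q => pM r P + pM r Q
  | PMul P Q => pM r P * pM r Q
  end.
Fixpoint pC (r : R) P : R := match P with
  | PVar _ => 1
  | PConst q => 0
  | PAdd P Q => pC r P + pC r Q
  | PMul P Q => pC r P * pM r Q + pM r P * pC r Q
  end.

Section Lipschitz.
Variables (K m : nat) (r : R) (X : nat -> 'M[C]_K).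
Hypothesis Xr : forall i, (i < m)%coq_nat -> opb r (X i).

Lemma opb_evalMx P : vars_lt m P -> opb (pM r P) (evalMx X P).
Proof.
elim: P => [i|q|P IHP Q IHQ|P IHP Q IHQ] /=; first exact: Xr.
- by move=> _; apply: opb_scalar.
- by case=> /IHP hP /IHQ hQ; apply: opbD.
- by case=> /IHP hP /IHQ hQ; apply: opbM.
Qed.

End Lipschitz.

Section Lipschitz2.
Variables (K m : nat) (r e : R) (X Y : nat -> 'M[C]_K).
Hypothesis Xr : forall i, (i < m)%coq_nat -> opb r (X i).
Hypothesis Yr : forall i, (i < m)%coq_nat -> opb r (Y i).

Lemma mulmx_diff (P P' Q Q' : 'M[C]_K) :
  P *m Q - P' *m Q' = (P - P') *m Q' + P *m (Q - Q').
Proof. by rewrite mulmxBl mulmxBr [RHS]addrC addrA subrK. Qed.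

Let pC_mulE P Q :
  (pC r P * pM r Q + pM r P * pC r Q) * e = pC r P * e * pM r Q + pM r P * (pC r Q * e).
Proof. by rewrite mulrDl mulrAC mulrA. Qed.

Lemma opb_evalMx_lip P : (forall i, (i < m)%coq_nat -> opb e (X i - Y i)) ->
  vars_lt m P -> opb (pC r P * e) (evalMx X P - evalMx Y P).
Proof.
move=> XY; elim: P => [i|q|P IHP Q IHQ|P IHP Q IHQ] /=; first by rewrite mul1r; apply: XY.
- by move=> _; rewrite subrr mul0r; apply: opb0.
- by case=> /IHP hP /IHQ hQ; rewrite mulrDl opprD addrACA; apply: opbD.
- case=> vP vQ; rewrite mulmx_diff pC_mulE; apply: opbD; apply: opbM.
  + exact: IHP.
  + exact: opb_evalMx Yr _ vQ.
  + exact: opb_evalMx Xr _ vP.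
  + exact: IHQ.
Qed.

Lemma frob_evalMx_lip P : (forall i, (i < m)%coq_nat -> frob e (X i - Y i)) ->
  vars_lt m P -> frob (pC r P * e) (evalMx X P - evalMx Y P).
Proof.
move=> XY; elim: P => [i|q|P IHP Q IHQ|P IHP Q IHQ] /=; first by rewrite mul1r; apply: XY.
- by move=> _; rewrite subrr mul0r; apply: frob0.
- by case=> /IHP hP /IHQ hQ; rewrite mulrDl opprD addrACA; apply: frobD.
- case=> vP vQ; rewrite mulmx_diff pC_mulE; apply: frobD.
  + apply: frob_opr; [exact: IHP|exact: opb_evalMx Yr _ vQ].
  + apply: frob_opl; [exact: opb_evalMx Xr _ vP|exact: IHQ].
Qed.

End Lipschitz2.

(** * Amplification by isometries with orthogonal ranges *)

Section Amplify.
Variables (n K k : nat) (U : 'I_n.+1 -> 'M[C]_(K, k)).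
Hypothesis UU : forall a b, (U a)^t* *m U b = ((a == b)%:R)%:M.
Hypothesis U1 : \sum_a U a *m (U a)^t* = 1%:M.

(** The [U a] identify C^K with n + 1 copies of C^k, and [ampl M] acts as [M] on each copy. It is
    the matrix counterpart of [phi]: a unital, isometric homomorphism. *)
Definition ampl (M : 'M[C]_k) : 'M[C]_K := \sum_a U a *m M *m (U a)^t*.

Lemma U_isom a : opb 1 (U a).
Proof. by apply: opb_isom; rewrite UU eqxx. Qed.

Lemma compress_ampl M a b : (U a)^t* *m ampl M *m U b = (a == b)%:R *: M.
Proof.
rewrite /ampl mulmx_sumr mulmx_suml (bigD1 b) //= !mulmxA UU -(mulmxA _ _ (U b)) UU eqxx.
rewrite mulmx1 mul_scalar_mx big1 ?addr0 // => c cb.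
by rewrite !mulmxA -(mulmxA _ _ (U b)) (UU c b) (negbTE cb) raddf0 mulmx0.
Qed.

Lemma ampl_mul_r M b : ampl M *m U b = U b *m M.
Proof.
rewrite /ampl mulmx_suml (bigD1 b) //= -mulmxA UU eqxx mulmx1 big1 ?addr0 // => c cb.
by rewrite -mulmxA UU (negbTE cb) raddf0 mulmx0.
Qed.

Lemma amplD M N : ampl (M + N) = ampl M + ampl N.
Proof. by rewrite /ampl -big_split /=; apply: eq_bigr => a _; rewrite mulmxDr mulmxDl. Qed.

Lemma amplM M N : ampl (M *m N) = ampl M *m ampl N.
Proof.
rewrite {3}/ampl mulmx_sumr; apply: eq_bigr => a _.
by rewrite !mulmxA ampl_mul_r.
Qed.

Lemma ampl_scalar z : ampl z%:M = z%:M.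
Proof.
rewrite /ampl -[RHS]mulmx1 -U1 mulmx_sumr; apply: eq_bigr => a _.
by rewrite mul_mx_scalar mul_scalar_mx scalemxAl.
Qed.

Lemma ampl_evalMx (A : nat -> 'M[C]_k) P :
  evalMx (fun i => ampl (A i)) P = ampl (evalMx A P).
Proof.
elim: P => [i|q|P IHP Q IHQ|P IHP Q IHQ] //=.
- by rewrite ampl_scalar.
- by rewrite IHP IHQ amplD.
- by rewrite IHP IHQ amplM.
Qed.

Lemma fro2_split p (v : 'M[C]_(K, p)) : fro2 v = \sum_a fro2 ((U a)^t* *m v).
Proof.
suff : (fro2 v)%:C%C = (\sum_a fro2 ((U a)^t* *m v))%:C%C by case.
have e : v^t* *m v = \sum_a ((U a)^t* *m v)^t* *m ((U a)^t* *m v).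
  rewrite -{2}[v]mul1mx -U1 mulmx_suml mulmx_sumr; apply: eq_bigr => a _.
  by rewrite adjM trmxCK !mulmxA.
rewrite fro2E e raddf_sum [RHS]raddf_sum; apply: eq_bigr => a _.
by rewrite -[RHS]/((fro2 ((U a)^t* *m v))%:C%C) fro2E.
Qed.

Lemma opb_ampl c M : opb c M -> opb c (ampl M).
Proof.
case=> c0 h; split=> // p v; rewrite (fro2_split (_ *m v)) (fro2_split v) mulr_sumr.
apply: ler_sum => a _; rewrite mulmxA.
have -> : (U a)^t* *m ampl M = M *m (U a)^t*.
  rewrite /ampl mulmx_sumr (bigD1 a) //= !mulmxA UU eqxx mul1mx big1 ?addr0 // => b ba.
  by rewrite !mulmxA UU eq_sym (negbTE ba) raddf0 !mul0mx.
by rewrite -mulmxA; apply: h.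
Qed.

Lemma opb_compress c (X : 'M[C]_K) a b : opb c X -> opb c ((U a)^t* *m X *m U b).
Proof.
move=> h; rewrite -[c]mulr1; apply: opbM (U_isom b); rewrite -[c]mul1r.
exact: opbM (opb_adj (U_isom a)) h.
Qed.

Lemma opb_of_ampl c M : opb c (ampl M) -> opb c M.
Proof.
by move=> /(@opb_compress _ _ ord0 ord0); rewrite compress_ampl eqxx scale1r.
Qed.

(** The squared Hilbert-Schmidt norm of the identity is K, and each of the n + 1 ranges contributes
    k to it. *)
Lemma dim_ampl : K = (n.+1 * k)%N.
Proof.
have h : fro2 (1%:M : 'M[C]_K) = \sum_(a < n.+1) k%:R.
  rewrite fro2_split; apply: eq_bigr => a _; rewrite mulmx1 fro2_adj -[RHS](fro21 R).
  suff : (fro2 (U a))%:C%C = (fro2 (1%:M : 'M[C]_k))%:C%C by case.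
  by rewrite !fro2E UU eqxx adj1 mul1mx.
move: h; rewrite fro21 sumr_const card_ord -[RHS]mulr_natr -natrM => /eqP.
by rewrite eqr_nat mulnC => /eqP.
Qed.

End Amplify.

(** * Compressing an approximate representation to a corner *)

Section CoreMx.
Variables (n K m : nat) (r d : R) (F : 'I_n.+1 -> 'M[C]_K) (X : nat -> 'M[C]_K).
Local Notation N := n.+1.
Local Notation f := ((F ord0)^t* *m F ord0).
Local Notation H a := (F a *m (F ord0)^t*).
Hypothesis F2 : forall a, opb 2 (F a).
Hypothesis FF : forall a b, opb d ((F a)^t* *m F b - (a == b)%:R *: f).
Hypothesis Ff : forall a, opb d (F a *m f - F a).
Hypothesis F1 : opb d (\sum_a F a *m (F a)^t* - 1%:M).
Hypothesis dn : N%:R ^+ 2 * 1000 * d <= 1.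
Hypothesis Xr : forall i, (i < m)%coq_nat -> opb r (X i).
Hypothesis Xsa : forall i, (i < m)%coq_nat -> (X i)^t* = X i.
Hypothesis XH : forall i, (i < m)%coq_nat ->
  opb d (X i - \sum_a H a *m X i *m (H a)^t*).
Hypothesis r0 : 0 <= r.

(** [d * kap N r] bounds the distance from X_i to the amplified compression: d comes from [XH], and
    each of the N terms costs 5 r eta with eta = 246 N d from [matrix_units]. *)
Definition kap (N : nat) (r : R) : R := 1 + N%:R * (5 * r * (246 * N%:R)).

(** The exact G_a = U_a U_0^* are close to H_a, and the sum of the G_a X_i G_a^* is precisely the
    amplification of the compression A_i. So [XH] makes X_i almost an amplification, and Lipschitz
    bounds extend this to polynomials. *)
Lemma core_mx : exists k, exists U : 'I_N -> 'M[C]_(K, k),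
  let A i := (U ord0)^t* *m X i *m U ord0 in
  [/\ (forall a b, (U a)^t* *m U b = ((a == b)%:R)%:M) /\
       \sum_a U a *m (U a)^t* = 1%:M,
      forall i, (i < m)%coq_nat -> opb r (A i) /\ (A i)^t* = A i,
      forall P, vars_lt m P ->
        opb (pC r P * (d * kap N r)) (evalMx X P - ampl U (evalMx A P)) &
      forall (S : 'I_N -> 'I_N -> ncpoly) (M c : R), (forall a b, vars_lt m (S a b)) ->
        (forall a b, pM r (S a b) <= M) -> (forall a b, pC r (S a b) <= c) ->
        opb (N%:R * (N%:R * (d * (5 * (246 * N%:R) * M + 4 * (c * kap N r)))))
        (\sum_a \sum_b H a *m evalMx X (S a b) *m (H b)^t* -
         \sum_a \sum_b U a *m evalMx A (S a b) *m (U b)^t*)].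
Proof.
have [k [U [UU U1 UF]]] := matrix_units (erefl f) F2 FF Ff F1 dn.
exists k, U => A; set eta := 246 * N%:R * d in UF.
pose G a := U a *m (U ord0)^t*.
have d0 := opb_ge0 F1.
have GH a : opb eta (H a - G a) by rewrite -opprB; apply: opbN; apply: UF.
have GH' a : opb eta ((H a)^t* - (G a)^t*) by rewrite -adjN -adjD; apply: opb_adj.
have H4 a : opb 4 (H a).
  have -> : 4 = 2 * 2 :> R by ring.
  exact: opbM (F2 a) (opb_adj (F2 _)).
have U1' a := U_isom UU a.
have G1 a : opb 1 (G a) by rewrite -[1]mulr1; apply: opbM (U1' a) (opb_adj (U1' _)).
have Ar i : (i < m)%coq_nat -> opb r (A i) by move/Xr => h; apply: opb_compress.
have diff2 a b (P Q : 'M[C]_K) (u v w : R) : opb u (P - Q) -> opb v P -> opb w Q ->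
    opb (eta * w + 4 * u + 4 * v * eta) (H a *m P *m (H b)^t* - G a *m Q *m (G b)^t*).
  move=> hu hv hw; rewrite -[_ + 4 * u]mulr1; apply: opb_diffM => //.
  - exact: opb_diffM.
  - exact: opbM.
  - by apply: opb_adj.
have XA i : (i < m)%coq_nat -> opb (d * kap N r) (X i - ampl U (A i)).
  move=> hi.
  have -> : X i - ampl U (A i) = (X i - \sum_a H a *m X i *m (H a)^t*) +
     \sum_a (H a *m X i *m (H a)^t* - G a *m X i *m (G a)^t*).
    rewrite sumrB addrA subrK; congr (_ - _); apply: eq_bigr => a _.
    by rewrite /A /G adjM trmxCK !mulmxA.
  have -> : d * kap N r = d + N%:R * (eta * r + 4 * 0 + 4 * r * eta).
    by rewrite /kap /eta; ring.
  apply: opbD; first exact: XH.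
  apply: opb_sum => a; apply: diff2 (Xr hi) (Xr hi).
  by rewrite subrr; apply: opb0.
have kap0 : 0 <= kap N r by rewrite addr_ge0 ?mulr_ge0.
have lip P : vars_lt m P -> opb (pC r P * (d * kap N r)) (evalMx X P - ampl U (evalMx A P)).
  move=> vP; rewrite -(ampl_evalMx UU U1); apply: (opb_evalMx_lip (m := m)) => //.
  by move=> i hi; apply: opb_ampl => //; apply: Ar.
split=> // [i hi|S M c vS hM hc].
  by split; [exact: Ar|rewrite /A !adjM trmxCK Xsa // mulmxA].
rewrite -sumrB; apply: opb_sum => a; rewrite -sumrB; apply: opb_sum => b.
(* Both sums now have the form required by [diff2], whose middle factors are close by [lip]. *)
have -> : U a *m evalMx A (S a b) *m (U b)^t* =
    G a *m ampl U (evalMx A (S a b)) *m (G b)^t*.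
  have h : (U ord0)^t* *m ampl U (evalMx A (S a b)) *m U ord0 = evalMx A (S a b).
    by rewrite compress_ampl // eqxx scale1r.
  by rewrite -[in LHS]h /G adjM trmxCK !mulmxA.
have -> : d * (5 * (246 * N%:R) * M + 4 * (c * kap N r)) =
   eta * M + 4 * (c * (d * kap N r)) + 4 * M * eta by rewrite /eta; ring.
apply: diff2.
- by apply: opb_le (lip _ (vS a b)); rewrite ler_wpM2r // mulr_ge0.
- by apply: opb_le (hM a b) _; apply: opb_evalMx (vS a b).
- apply: opb_le (hM a b) _; apply: opb_ampl => //.
  by apply: opb_evalMx (vS a b).
Qed.

End CoreMx.

(** * The extended tuple *)

(* The variables [4a], [4a+1], [4i+2] and [4j+3] stand for [e_a0], [e_0a],
   [x_i (x) 1] and [y_j]. *)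
Definition ext T (c d u v : nat -> T) (i : nat) : T :=
  match (i %% 4)%N with
  | 0%N => c (i %/ 4)%N | 1%N => d (i %/ 4)%N | 2%N => u (i %/ 4)%N | _ => v (i %/ 4)%N
  end.
Definition vc a := PVar (a * 4)%N.
Definition vd a := PVar (a * 4 + 1)%N.
Definition vx i := PVar (i * 4 + 2)%N.
Definition vy j := PVar (j * 4 + 3)%N.

Lemma ext_c T (c d u v : nat -> T) a : ext c d u v (a * 4)%N = c a.
Proof. by rewrite /ext modnMl mulnK. Qed.
Lemma ext_d T (c d u v : nat -> T) a : ext c d u v (a * 4 + 1)%N = d a.
Proof. by rewrite /ext modnMDl divnMDl // addn0. Qed.
Lemma ext_x T (c d u v : nat -> T) a : ext c d u v (a * 4 + 2)%N = u a.
Proof. by rewrite /ext modnMDl divnMDl // addn0. Qed.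
Lemma ext_y T (c d u v : nat -> T) a : ext c d u v (a * 4 + 3)%N = v a.
Proof. by rewrite /ext modnMDl divnMDl // addn0. Qed.

Lemma ext_ind T (P : nat -> T -> Prop) (c d u v : nat -> T) :
  (forall a, P (a * 4)%N (c a)) -> (forall a, P (a * 4 + 1)%N (d a)) ->
  (forall a, P (a * 4 + 2)%N (u a)) -> (forall a, P (a * 4 + 3)%N (v a)) ->
  forall i, P i (ext c d u v i).
Proof.
move=> hc hd hu hv i; rewrite {1}(divn_eq i 4) /ext.
have : (i %% 4 < 4)%N by rewrite ltn_pmod.
by case: (i %% 4)%N => [|[|[|[|k]]]] // _; rewrite ?addn0.
Qed.

(** Formal adjoints and real parts make X_(4a+1) exactly the adjoint of X_(4a) and X_(4i+2) exactly
    self-adjoint on a microstate. The default [pzero] keeps all variables below p. *)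
Definition ext_poly p (Cp W : nat -> ncpoly) := ext Cp (fun a => pstar (Cp a))
  (fun i => psym (W i)) (fun j => if (j < p)%N then PVar j else pzero).

(* The relations below hold in [B], up to a small error for [rel5]; on a microstate
   they are therefore satisfied approximately. *)
Definition rel1 a b := psub (PMul (vd a) (vc b))
  (if a == b :> nat then PMul (vd 0) (vc 0) else pzero).
Definition rel2 a := psub (PMul (vc a) (PMul (vd 0) (vc 0))) (vc a).
Definition rel3 N := psub (psumn N (fun a => PMul (vc a) (vd a))) pone.
Definition pH a := PMul (vc a) (vd 0).
Definition pHs a := PMul (vc 0) (vd a).
Definition rel4 N i := psub (vx i) (psumn N (fun a => PMul (PMul (pH a) (vx i)) (pHs a))).
Definition px P := psubst vx P.
Definition rel5 N (S : nat -> nat -> nat -> ncpoly) j := psub (vy j)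
  (psumn N (fun a => psumn N (fun b => PMul (PMul (pH a) (px (S j a b))) (pHs b)))).

Section Rep.
Variables (A B : CStarAlgebra) (n : nat) (Psi : B -> nat -> nat -> A).
Hypothesis tens : is_tensor_Mn A n.+1 B Psi.
Variables (m p : nat) (x : nat -> A) (y : nat -> B).
Hypothesis xsa : forall i, cstar (x i) = x i.
Hypothesis ysa : forall j, (j < p)%coq_nat -> cstar (y j) = y j.
Hypothesis gen : generates B y p.
Local Notation N := n.+1.

Definition ext_gen := ext (fun a => unitB tens (inord a) ord0) (fun a => unitB tens ord0 (inord a))
  (fun i => phi tens (x i)) (fun j => if (j < p)%N then y j else 0).

Lemma vars_ext_poly Cp W : (forall a, vars_lt p (Cp a)) -> (forall i, vars_lt p (W i)) ->
  forall i, vars_lt p (ext_poly p Cp W i).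
Proof.
move=> hC hW; apply: (ext_ind (P := fun _ P => vars_lt p P)) => // [a|i|j].
  exact: vars_pstar.
  exact: vars_psym.
by case: ifP => // /ssrnat.ltP.
Qed.

(** Continuity at the exact tuple for a finite list: approximating the entries of [ext_gen] closely
    enough controls the norms of all listed polynomials, and these norms are then read off from the
    exact relations. *)
Lemma approx_ext (L : seq ncpoly) (d : R) : 0 < d -> exists Cp W : nat -> ncpoly,
  [/\ forall a, vars_lt p (Cp a), forall i, vars_lt p (W i) &
   forall P, In P L ->
     `|cnorm (evalA B y (psubst (ext_poly p Cp W) P)) - cnorm (evalA B ext_gen P)| <= d].
Proof.
move=> d0; have [e [e0 he]] := evalA_continuous_seq ext_gen L d0.
have ap b : exists P, vars_lt p P /\ cnorm (evalA B y P - b) < e := dense ysa gen b e0.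
have [Cp hC] := choice (fun a => ap (unitB tens (inord a) ord0)).
have [W hW] := choice (fun i => ap (phi tens (x i))).
exists Cp, W; split=> [a|i|P hP]; [by have [] := hC a|by have [] := hW i|].
apply: le_trans (norm_dist _ _) _; rewrite ev_psubst; apply: he => // {hP P}.
rewrite /ext_gen; apply: (ext_ind (P := fun i b => cnorm (evalA B y (ext_poly p Cp W i) - b) <= e)) => [a|a|i|j].
- by rewrite /ext_poly ext_c ltW //; have [] := hC a.
- rewrite /ext_poly ext_d; have [vC /ltW h] := hC a.
  by rewrite (ev_pstar ysa vC) -(unitB_star tens) -starN -starD norm_star.
- rewrite /ext_poly ext_x; have [vW /ltW h] := hW i; apply: le_trans h.
  by apply: ev_psym ysa vW _; rewrite -phi_star xsa.
- by rewrite /ext_poly ext_y; case: ifP => _; rewrite ?ev0 subrr norm0 ltW.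
Qed.

Lemma ext_gen_c a : evalA B ext_gen (vc a) = unitB tens (inord a) ord0.
Proof. exact: ext_c. Qed.
Lemma ext_gen_d a : evalA B ext_gen (vd a) = unitB tens ord0 (inord a).
Proof. exact: ext_d. Qed.
Lemma ext_gen_x i : evalA B ext_gen (vx i) = phi tens (x i).
Proof. exact: ext_x. Qed.
Lemma ext_gen_y j : (j < p)%N -> evalA B ext_gen (vy j) = y j.
Proof. by move=> h; rewrite [LHS]ext_y h. Qed.
Lemma inord0 : inord 0 = ord0 :> 'I_N.
Proof. by apply: val_inj; rewrite /= inordK. Qed.
Lemma ext_gen_px P : evalA B ext_gen (px P) = phi tens (evalA A x P).
Proof.
rewrite ev_psubst -evalA_phi; congr (evalA B _ P); apply: funext => i; exact: ext_gen_x.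
Qed.
Lemma ext_gen_H a : evalA B ext_gen (pH a) = unitB tens (inord a) ord0.
Proof. by rewrite evM ext_gen_c ext_gen_d inord0 unitB_mul eqxx. Qed.
Lemma ext_gen_Hs a : evalA B ext_gen (pHs a) = unitB tens ord0 (inord a).
Proof. by rewrite evM ext_gen_c ext_gen_d inord0 unitB_mul eqxx. Qed.

Lemma ext_gen_rel1 a b : (a < N)%N -> (b < N)%N -> evalA B ext_gen (rel1 a b) = 0.
Proof.
move=> ha hb; rewrite evB evM ext_gen_c ext_gen_d unitB_mul.
rewrite -(inj_eq val_inj) /= !inordK //; case: eqP => _; rewrite ?ev0 ?subr0 //.
by rewrite evM ext_gen_c ext_gen_d inord0 unitB_mul eqxx subrr.
Qed.
Lemma ext_gen_rel2 a : evalA B ext_gen (rel2 a) = 0.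
Proof. by rewrite evB !evM !ext_gen_c !ext_gen_d inord0 !unitB_mul ?eqxx ?unitB_mul ?eqxx subrr. Qed.
Lemma ext_gen_rel3 : evalA B ext_gen (rel3 N) = 0.
Proof.
rewrite evB ev1 ev_psumn -(unitB_sum tens); apply/eqP; rewrite subr_eq0; apply/eqP.
by apply: eq_bigr => i _; rewrite evM ext_gen_c ext_gen_d inord_val unitB_mul eqxx.
Qed.
Lemma ext_gen_rel4 i : evalA B ext_gen (rel4 N i) = 0.
Proof.
rewrite evB ev_psumn ext_gen_x; apply/eqP; rewrite subr_eq0; apply/eqP.
rewrite -[LHS]mulr1 -(unitB_sum tens) mulr_sumr; apply: eq_bigr => a _.
by rewrite evM evM ext_gen_x ext_gen_H ext_gen_Hs inord_val -phi_unitBC -mulrA unitB_mul eqxx.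
Qed.
(** Compare with [decompB] term by term; matrix units have norm at most 1 and [phi] is isometric, so
    each of the N^2 terms costs at most e. *)
Lemma ext_gen_rel5 S j (e : R) : (j < p)%N -> (forall a b, (a < N)%N -> (b < N)%N ->
   cnorm (evalA A x (S j a b) - Psi (y j) a b) <= e) ->
  cnorm (evalA B ext_gen (rel5 N S j)) <= N%:R * (N%:R * e).
Proof.
move=> hj h; rewrite evB ext_gen_y // ev_psumn [in X in X - _](decompB tens (y j)) -sumrB.
have ns (F : 'I_N -> B) (u : R) : (forall a, cnorm (F a) <= u) ->
    cnorm (\sum_a F a) <= N%:R * u.
  move=> hF; have -> : N%:R * u = \sum_(a < N) u by rewrite sumr_const card_ord mulr_natl.
  apply: (big_ind2 (fun b v => cnorm b <= v)) => [|b1 v1 b2 v2 h1 h2|a _] //.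
    by rewrite norm0.
  by apply: le_trans (normD _ _) _; apply: lerD.
apply: (ns) => a; rewrite ev_psumn -sumrB; apply: (ns) => b.
rewrite evM evM ext_gen_px ext_gen_H ext_gen_Hs !inord_val !unitB_mul eqxx -mulrBl -mulrBr.
apply: le_trans (normM _ _) _; rewrite -[e]mulr1.
apply: ler_pM; rewrite ?norm_ge0 ?norm_unitB //.
apply: le_trans (normM _ _) _; rewrite -[e]mul1r.
apply: ler_pM; rewrite ?norm_ge0 ?norm_unitB //.
have -> : phi tens (Psi (y j) a b) - phi tens (evalA A x (S j a b)) =
    phi tens (Psi (y j) a b - evalA A x (S j a b)).
  by apply: (addIr (phi tens (evalA A x (S j a b)))); rewrite subrK -phiD subrK.
by rewrite norm_phi norm_distC; apply: h.
Qed.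

End Rep.

(** * Extended reals, and the matrices of the statement *)

Lemma Rbar_le_trans b a c : Rbar_le a b -> Rbar_le b c -> Rbar_le a c.
Proof. by case: a b c => [r||] [s||] [t||] //=; apply: Rle_trans. Qed.

(** Existence is what gives the [epsilon] in [Rbar_sup] its meaning. *)
Lemma is_sup_ex P : exists l, is_sup P l.
Proof.
have [hP|hP] := pselect (P PInf).
  by exists PInf; split=> [[]//|u hu]; apply: hu.
have [hr|hr] := pselect (exists r, P (Fin r)); last first.
  exists MInf; split=> [[r||]|] // h; by case: hr; exists r.
have [hb|hb] := pselect (bound (fun r => P (Fin r))); last first.
  exists PInf; split=> [[]//|[u||] hu] //; last by have [r /hu] := hr.
  by case: hb; exists u => r /hu.
have [l [ub lub]] := completeness _ hb hr.
exists (Fin l); split=> [[r||] h|[u||] hu] //=; first exact: ub.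
  by apply: lub => r /hu.
by have [r /hu] := hr.
Qed.

Lemma is_inf_ex P : exists l, is_inf P l.
Proof.
have [l [h1 h2]] := is_sup_ex (fun u => forall x, P x -> Rbar_le u x).
by exists l; split=> [x hx|u hu]; [apply: h2 => u; apply|apply: h1].
Qed.

Lemma Rbar_supP P : is_sup P (Rbar_sup P).
Proof. exact: epsilon_spec (is_sup_ex P). Qed.
Lemma Rbar_infP P : is_inf P (Rbar_inf P).
Proof. exact: epsilon_spec (is_inf_ex P). Qed.

Definition tomx K (X : mat) : 'M[C]_K := \matrix_(i, j) toC (X i j).
Definition ofC (z : C) : Cpx := mkC (complex.Re z) (complex.Im z).
Definition ofmx K (X : 'M[C]_K) : mat := fun a b =>
  match insub a, insub b with Some i, Some j => ofC (X i j) | _, _ => Defs.C0 end.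

Lemma toC_inj : injective toC.
Proof. by move=> [a b] [c d] [-> ->]. Qed.
Lemma ofmxK K (X : 'M[C]_K) : tomx K (ofmx X) = X.
Proof.
by apply/matrixP => i j; rewrite mxE /ofmx !valK; case: (X i j).
Qed.

Lemma toCD z w : toC (Cadd z w) = toC z + toC w. Proof. by []. Qed.
Lemma toCM z w : toC (Cmul z w) = toC z * toC w.
Proof. by []. Qed.
Lemma toC_sum k f : toC (Csum k f) = \sum_(i < k) toC (f i).
Proof. by elim: k => [|k IH]; rewrite ?big_ord0 // big_ord_recr /= toCD IH. Qed.
Lemma Rsum_sum k f : Rsum k f = \sum_(i < k) f i.
Proof. by elim: k => [|k IH]; rewrite ?big_ord0 // big_ord_recr /= IH. Qed.
Lemma Cabs2E z : Cabs2 z = nsq (toC z).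
Proof. by rewrite /Cabs2 !RpowE. Qed.

Section Bridge.
Variable K : nat.
Local Notation mx := (tomx K).

Lemma mx_madd X Y : mx (madd X Y) = mx X + mx Y.
Proof. by apply/matrixP => i j; rewrite !mxE. Qed.
Lemma mx_msub X Y : mx (msub X Y) = mx X - mx Y.
Proof. by apply/matrixP => i j; rewrite !mxE. Qed.
Lemma mx_mmul X Y : mx (mmul K X Y) = mx X *m mx Y.
Proof.
apply/matrixP => i j; rewrite !mxE toC_sum; apply: eq_bigr => l _.
by rewrite toCM !mxE.
Qed.
Lemma mx_madj X : mx (madj X) = (mx X)^t*.
Proof. by apply/matrixP => i j; rewrite !mxE. Qed.
Lemma mx_mscal c : mx (mscal c) = (toC c)%:M.
Proof.
apply/matrixP => i j; rewrite !mxE /mscal.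
have -> : Nat.eqb i j = (i == j).
  rewrite -[RHS]/(i == j :> nat); case: eqP => [->|/PeanoNat.Nat.eqb_neq //].
  exact: PeanoNat.Nat.eqb_refl.
by case: (i == j).
Qed.
Lemma mx_evalM T P : mx (evalM K T P) = evalMx (fun i => mx (T i)) P.
Proof.
elim: P => [i|q|P IHP Q IHQ|P IHP Q IHQ] //=.
- exact: mx_mscal.
- by rewrite mx_madd IHP IHQ.
- by rewrite mx_mmul IHP IHQ.
Qed.
Lemma mat_eqP X Y : mat_eq K X Y <-> mx X = mx Y.
Proof.
split=> [h|/matrixP h a b /ssrnat.ltP ha /ssrnat.ltP hb].
  by apply/matrixP => i j; rewrite !mxE h //; apply/ssrnat.ltP.
by have := h (Ordinal ha) (Ordinal hb); rewrite !mxE => /toC_inj.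
Qed.
Lemma mat_selfadjP X : mat_selfadj K X <-> (mx X)^t* = mx X.
Proof.
by rewrite -mx_madj; split=> [h|/mat_eqP h]; [apply/mat_eqP => a b ha hb; rewrite [RHS]h|move=> a b ha hb; rewrite -[LHS]h].
Qed.
Lemma unitaryP W : unitary K W <-> (mx W)^t* *m mx W = 1%:M /\ mx W *m (mx W)^t* = 1%:M.
Proof. by rewrite /unitary !mat_eqP !mx_mmul mx_madj mx_mscal toC1. Qed.

Lemma norm2E n T : norm2 n K T = Num.sqrt (\sum_(i < n) K%:R^-1 * fro2 (mx (T i))).
Proof.
rewrite /norm2 RsqrtE Rsum_sum; congr Num.sqrt; apply: eq_bigr => i _.
rewrite /tau -INRE.
have h : toC (Csum K (fun a => mmul K (madj (T i)) (T i) a a)) = (fro2 (mx (T i)))%:C%C.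
  rewrite fro2E toC_sum; apply: eq_bigr => a _.
  by rewrite -mx_madj -mx_mmul mxE.
have -> : Csum K (fun a => mmul K (madj (T i)) (T i) a a) = mkC (fro2 (mx (T i))) 0.
  by apply: toC_inj; rewrite h.
by rewrite /= RmultE RminusE !RmultE mul0r subr0 RinvE.
Qed.

Lemma fro2_cv (v : 'cV[C]_K) : fro2 v = \sum_i nsq (v i 0).
Proof. by apply: eq_bigr => i _; rewrite big_ord1. Qed.

Definition opset X : Rbar -> Prop := fun r => exists v : nat -> Cpx,
      Rle (Rsum K (fun j => Cabs2 (v j))) 1 /\
      r = Fin (sqrt (Rsum K (fun a => Cabs2 (Csum K (fun j => Cmul (X a j) (v j)))))).

Lemma opsetP X r : opset X r <-> exists v : 'cV[C]_K,
  fro2 v <= 1 /\ r = Fin (Num.sqrt (fro2 (mx X *m v))).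
Proof.
have e1 (v : nat -> Cpx) : Rsum K (fun j => Cabs2 (v j)) = fro2 (\col_(i < K) toC (v i)).
  by rewrite fro2_cv Rsum_sum; apply: eq_bigr => i _; rewrite Cabs2E mxE.
have e2 (v : nat -> Cpx) : Rsum K (fun a => Cabs2 (Csum K (fun j => Cmul (X a j) (v j)))) =
   fro2 (mx X *m \col_(i < K) toC (v i)).
  rewrite fro2_cv Rsum_sum; apply: eq_bigr => i _; rewrite Cabs2E toC_sum !mxE.
  by congr nsq; apply: eq_bigr => j _; rewrite toCM !mxE.
split=> [[v []]|[v [h1 h2]]].
  by rewrite e1 e2 RsqrtE => /RleP h ->; eexists; split; [exact: h|].
pose w i := match insub i with Some j => ofC (v j 0) | None => Defs.C0 end.
have wE : \col_(i < K) toC (w i) = v.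
  by apply/colP => i; rewrite mxE /w valK; case: (v i 0).
by exists w; rewrite e1 e2 wE RsqrtE h2; split=> //; apply/RleP.
Qed.

(** Bounds the set defining [mat_opnorm]; an infinite supremum would be turned into 0 by
    [Rbar_real]. *)
Lemma opb_fro m n (M : 'M[C]_(m, n)) : opb (Num.sqrt (fro2 M)) M.
Proof.
apply: opb_col => [|v]; first exact: sqrtr_ge0.
have hv : opb (Num.sqrt (fro2 v)) v.
  split=> [|p N]; first exact: sqrtr_ge0.
  rewrite sqr_sqrtr ?fro2_ge0 // /fro2 mulr_suml; apply: ler_sum => i _.
  rewrite !big_ord1 mulr_sumr; apply: ler_sum => j _.
  by rewrite mxE big_ord1 nsqM.
have hM : frob (Num.sqrt (fro2 M)) M by split; rewrite ?sqrtr_ge0 // sqr_sqrtr ?fro2_ge0.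
have [_] := frob_opr hM hv; rewrite exprMn !sqr_sqrtr ?fro2_ge0 //.
Qed.

Lemma opnorm_lub X : exists l : R, mat_opnorm K X = l /\ 0 <= l /\ is_sup (opset X) (Fin l).
Proof.
have h := Rbar_supP (opset X); rewrite /mat_opnorm -/(opset X).
case: (Rbar_sup (opset X)) h => [l||] /= [ub lub].
- exists l; split=> //; split=> //.
  have : Rbar_le (Fin (Num.sqrt (fro2 (mx X *m (0 : 'cV_K))))) (Fin l).
    by apply: ub; apply/opsetP; exists 0; rewrite fro20 ler01.
  by rewrite mulmx0 fro20 sqrtr0 => /RleP.
- have /= [] := lub (Fin (Num.sqrt (fro2 (mx X)))).
  move=> r /opsetP [v [hv ->]]; apply/RleP; rewrite ler_sqrt ?fro2_ge0 //.
  have [_ /(_ _ v)] := opb_fro (mx X); rewrite sqr_sqrtr ?fro2_ge0 // => /le_trans; apply.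
  by rewrite -[leRHS]mulr1 ler_wpM2l ?fro2_ge0.
- have := ub (Fin (Num.sqrt (fro2 (mx X *m (0 : 'cV_K))))); rewrite /=; case.
  by apply/opsetP; exists 0; rewrite fro20 ler01.
Qed.

Lemma opnorm_ge0 X : 0 <= mat_opnorm K X.
Proof. by have [l [-> []]] := opnorm_lub X. Qed.

(** The dictionary between the norm of the statement, a supremum over the unit ball, and the
    homogeneous bound [opb]; the forward direction normalises the vector. *)
Lemma opnormP X (c : R) : 0 <= c -> mat_opnorm K X <= c <-> opb c (mx X).
Proof.
have [l [-> [l0 [ub lub]]]] := opnorm_lub X => c0; split=> [lc|[_ h]].
  apply: opb_col => // v; have := fro2_ge0 v; rewrite le_eqVlt => /orP [/eqP v0|v0].
    by rewrite -v0 (fro2_eq0 (esym v0)) mulmx0 fro20 mulr0.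
  set s := Num.sqrt (fro2 v); have ss : s ^+ 2 = fro2 v by rewrite sqr_sqrtr // ltW.
  have s0 : 0 < s by rewrite sqrtr_gt0.
  pose w := (s^-1)%:C%C *: v.
  have vw : v = s%:C%C *: w by rewrite scalerA -rmorphM divff ?gt_eqF // scale1r.
  have fw : fro2 w = 1 by rewrite fro2Z nsq_real -ss -exprMn mulVf ?gt_eqF // expr1n.
  have : Rbar_le (Fin (Num.sqrt (fro2 (mx X *m w)))) (Fin l).
    by apply: ub; apply/opsetP; exists w; rewrite fw.
  move=> /RleP hw; rewrite {1}vw -scalemxAr fro2Z nsq_real ss mulrC.
  rewrite ler_wpM2r ?(ltW v0) //.
  rewrite -[leLHS]sqr_sqrtr ?fro2_ge0 // ler_sqr ?nnegrE ?sqrtr_ge0 //.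
  exact: le_trans hw lc.
have : Rbar_le (Fin l) (Fin c); last by move=> /RleP.
apply: lub => r /opsetP [v [hv ->]]; apply/RleP.
rewrite -(ler_sqr (sqrtr_ge0 _) c0) sqr_sqrtr ?fro2_ge0 //.
by apply: le_trans (h _ v) _; rewrite -[leRHS]mulr1 ler_wpM2l ?exprn_ge0.
Qed.

Lemma opb_opnorm X : opb (mat_opnorm K X) (mx X).
Proof. by apply/opnormP; rewrite ?opnorm_ge0. Qed.

End Bridge.

(** * Microstates of the tensor product *)

Lemma common_bound N (Q : nat -> R -> Prop) :
  (forall i, exists M, Q i M) -> (forall i M M', M <= M' -> Q i M -> Q i M') ->
  exists M : R, 0 <= M /\ forall i, (i < N)%N -> Q i M.
Proof.
move=> ex mono; elim: N => [|N [M [M0 IH]]]; first by exists 0.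
have [M' hM'] := ex N; exists (Num.max M M'); split=> [|i].
  by rewrite le_max M0.
rewrite ltnS leq_eqVlt => /orP [/eqP ->|/IH h].
  by apply: mono hM'; rewrite le_max lexx orbT.
by apply: mono h; rewrite le_max lexx.
Qed.

Lemma small_factor (c e : R) : 0 <= c -> 0 < e ->
  exists d0 : R, 0 < d0 /\ forall d, 0 <= d -> d <= d0 -> d * c <= e.
Proof.
move=> c0 e0; have c1 : 0 < c + 1 by rewrite ltr_wpDl.
exists (e / (c + 1)); split=> [|d d0 hd]; first by rewrite divr_gt0.
rewrite ler_pdivlMr // in hd; apply: le_trans hd.
by rewrite ler_wpM2l // lerDl.
Qed.

Definition tab N (f : nat -> ncpoly) := List.map f (List.seq 0 N).
Lemma in_tab N f i : (i < N)%N -> In (f i) (tab N f).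
Proof.
move=> /ssrnat.ltP hi; apply: List.in_map; apply/List.in_seq; split=> //.
exact: PeanoNat.Nat.le_0_l.
Qed.
Definition tab2 N (f : nat -> nat -> ncpoly) := List.flat_map (fun i => tab N (f i)) (List.seq 0 N).
Lemma in_tab2 N f i j : (i < N)%N -> (j < N)%N -> In (f i j) (tab2 N f).
Proof.
move=> /ssrnat.ltP hi hj; apply/List.in_flat_map; exists i; split; last exact: in_tab.
by apply/List.in_seq; split=> //; exact: PeanoNat.Nat.le_0_l.
Qed.

Section Core.
Variables (A B : CStarAlgebra) (n : nat) (Psi : B -> nat -> nat -> A).
Hypothesis tens : is_tensor_Mn A n.+1 B Psi.
Variables (m p : nat) (x : nat -> A) (y : nat -> B).
Hypothesis xsa : forall i, cstar (x i) = x i.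
Hypothesis genx : generates A x m.
Hypothesis ysa : forall j, (j < p)%coq_nat -> cstar (y j) = y j.
Hypothesis geny : generates B y p.
Local Notation N := n.+1.

(** Up to w in operator norm, each T_j is the block matrix of the S_jst(a), seen through the
    identification given by [U]. So a microstate [a] of [x], together with [U], determines T
    approximately. *)
Definition matrix_model (r eps : R) (L : seq ncpoly) (S : nat -> nat -> nat -> ncpoly) (w : R)
  K k (T : nat -> mat) (U : 'I_N -> 'M[C]_(K, k)) (a : nat -> 'M[C]_k) :=
  [/\ forall a b, (U a)^t* *m U b = ((a == b)%:R)%:M,
      \sum_a U a *m (U a)^t* = 1%:M,
      Gamma_top A x m r k eps L (fun i => ofmx (a i)) &
      forall j, (j < p)%N -> opb w (tomx K (T j) -
        \sum_(s < N) \sum_(t < N) U s *m evalMx a (S j s t) *m (U t)^t*)].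

(** The slack 1 absorbs the error d <= 1 with which a microstate reproduces the norm of x_i (x)
    1. *)
Lemma norm_radius : exists r : R, 0 < r /\ forall i, (i < m)%N -> cnorm (x i) + 1 <= r.
Proof.
have [|i M M' h1 h2|M [M0 hM]] := @common_bound m (fun i M => cnorm (x i) + 1 <= M).
- by move=> i; exists (cnorm (x i) + 1).
- exact: le_trans h1.
exists (M + 1); split=> [|i /hM h]; first by rewrite ltr_wpDl.
by apply: le_trans h _; rewrite lerDl.
Qed.

Lemma approx_entries (t : R) : 0 < t -> exists S : nat -> nat -> nat -> ncpoly,
  forall j a b, vars_lt m (S j a b) /\ cnorm (evalA A x (S j a b) - Psi (y j) a b) < t.
Proof.
move=> t0.
have [S hS] := choice (fun v : nat * nat * nat =>
  dense (fun i _ => xsa i) genx (Psi (y v.1.1) v.1.2 v.2) t0).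
by exists (fun j a b => S (j, a, b)) => j a b; exact: (hS (j, a, b)).
Qed.

(** [S] is chosen before eps' and L', so that later w' may depend on it; eps and L are chosen before
    the cutoff [Rr] and the size [K]. *)
Lemma matrix_model_ex (r w1 : R) : 0 < r -> (forall i, (i < m)%N -> cnorm (x i) + 1 <= r) ->
  0 < w1 -> exists S : nat -> nat -> nat -> ncpoly, (forall j a b, vars_lt m (S j a b)) /\
  forall (eps' : R) L', 0 < eps' -> Forall (vars_lt m) L' ->
  exists (eps : R) L, 0 < eps /\ Forall (vars_lt p) L /\
  forall Rr K T, Gamma_top B y p Rr K eps L T ->
  exists k (U : 'I_N -> 'M[C]_(K, k)) a, matrix_model r eps' L' S w1 T U a.
Proof.
move=> r0 hr w10; have r0' := ltW r0.
have N0 : 0 < N%:R :> R by rewrite ltr0n.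
(* The N^2 entries of a block matrix then add up to an error w1 / 4. *)
have t0 : 0 < w1 / 4 / (N%:R * N%:R) by rewrite !divr_gt0 ?mulr_gt0.
have [S hS] := approx_entries t0; exists S; split=> [j a b|]; first by have [] := hS j a b.
have [M [M0 hM]] : exists M : R, 0 <= M /\ forall j, (j < p)%N -> forall a, (a < N)%N ->
    forall b, (b < N)%N -> pM r (S j a b) <= M /\ pC r (S j a b) <= M.
  apply: common_bound => [j|j M M' MM h a ha b hb]; last first.
    by have [h1 h2] := h a ha b hb; split; apply: le_trans MM.
  have [|a M M' MM h b hb|M [_ hM]] := @common_bound N (fun a M => forall b, (b < N)%N ->
     pM r (S j a b) <= M /\ pC r (S j a b) <= M); last by exists M.
    move=> a; have [|b M M' MM [h1 h2]|M [_ hM]] := @common_bound N (fun b M =>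
       pM r (S j a b) <= M /\ pC r (S j a b) <= M); last by exists M.
      by move=> b; exists (Num.max (pM r (S j a b)) (pC r (S j a b))); rewrite !le_max !lexx orbT.
    by split; apply: le_trans MM.
  by have [h1 h2] := h b hb; split; apply: le_trans MM.
move=> eps' L' eps'0 vL'.
have [M' [M'0 hM']] : exists M' : R, 0 <= M' /\ forall P, In P L' -> pC r P <= M'.
  elim: {vL'} L' => [|P L [M' [M'0 IH]]]; first by exists 0.
  exists (Num.max M' (pC r P)); split=> [|Q [<-|/IH h]]; first by rewrite le_max M'0.
    by rewrite le_max lexx orbT.
  by rewrite le_max h.
have kap0 : 0 <= kap N r by rewrite addr_ge0 ?mulr_ge0.
have [d1 [d10 hd1]] := small_factor (mulr_ge0 (exprn_ge0 2 (ltW N0)) (ler0n R 1000)) ltr01.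
have [d2 [d20 hd2]] := small_factor
  (addr_ge0 (mulr_ge0 M'0 kap0) (ler0n R 1)) eps'0.
set K5 : R := 5 * (246 * N%:R) * M + 4 * (M * kap N r).
have K50 : 0 <= K5 by rewrite addr_ge0 ?mulr_ge0.
have w2 : 0 < w1 / 2 by rewrite divr_gt0.
have [d3 [d30 hd3]] := small_factor (addr_ge0 (mulr_ge0 (ltW N0) (mulr_ge0 (ltW N0) K50)) (ler0n R 1)) w2.
(* The four bounds serve, in order: [matrix_units], the tolerance eps', the model error w1 / 2 left
   beside w1 / 4, and the slack in the radius r. *)
pose d : R := Num.min (Num.min d1 d2) (Num.min d3 1).
have d0 : 0 < d by rewrite !lt_min d10 d20 d30 ltr01.
have {hd1} hd1 : d * (N%:R ^+ 2 * 1000) <= 1.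
  by apply: hd1 (ltW d0) _; rewrite !ge_min lexx.
have {hd2} hd2 : d * (M' * kap N r + 1) <= eps'.
  by apply: hd2 (ltW d0) _; rewrite !ge_min lexx orbT.
have {hd3} hd3 : d * (N%:R * (N%:R * K5) + 1) <= w1 / 2.
  by apply: hd3 (ltW d0) _; rewrite !ge_min lexx ?orbT.
have d_le1 : d <= 1 by rewrite !ge_min lexx ?orbT.
clearbody d.
(* Besides the relations, [px] of L' transfers the norm conditions on [x], while [vc] and [vx]
   supply the bounds on the F_a and X_i. *)
pose Ls := (tab2 N rel1 ++ tab N rel2 ++ (cons (rel3 N) nil) ++ tab m (rel4 N) ++
  tab p (rel5 N S) ++ List.map px L' ++ tab N vc ++ tab m vx)%list.
have d20' : 0 < d / 2 by rewrite divr_gt0.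
have [Cp [W [vC vW hap]]] := approx_ext tens xsa ysa geny Ls d20'.
(* Half of d pays for the approximation in [B], the other half for the tolerance of the
   microstate. *)
exists (d / 2), (List.map (psubst (ext_poly p Cp W)) Ls); split=> //; split.
  apply/List.Forall_forall => _ /List.in_map_iff [P [<- _]].
  by apply: vars_psubst; apply: vars_ext_poly.
move=> Rr K T [Tb TL].
pose X i := evalMx (fun i => tomx K (T i)) (ext_poly p Cp W i).
have key P : In P Ls -> exists q : R, [/\ `|q - cnorm (evalA B (ext_gen tens p x y) P)| <= d,
    opb q (evalMx X P) & forall c, opb c (evalMx X P) -> q <= c].
  move=> hP; exists (mat_opnorm K (evalM K T (psubst (ext_poly p Cp W) P))); split.
  - have h1 := hap P hP.
    have := TL (psubst (ext_poly p Cp W) P) (List.in_map _ _ _ hP) => /RleP; rewrite RabsE => h2.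
    by rewrite [d]splitr; apply: le_trans (ler_distD _ _ _) (lerD h2 h1).
  - by have := opb_opnorm K (evalM K T (psubst (ext_poly p Cp W) P)); rewrite mx_evalM mx_ev_psubst.
  move=> c hc; apply/opnormP; first exact: opb_ge0 hc.
  by rewrite mx_evalM mx_ev_psubst.
have key_le P (e : R) : In P Ls -> cnorm (evalA B (ext_gen tens p x y) P) <= e ->
    opb (e + d) (evalMx X P).
  move=> hP he; have [q [hq hX _]] := key P hP; apply: opb_le hX.
  by move: hq; rewrite ler_norml => /andP [_ hq]; lra.
have key0 P : In P Ls -> evalA B (ext_gen tens p x y) P = 0 -> opb d (evalMx X P).
  by move=> hP h0; rewrite -[d]add0r; apply: key_le hP _; rewrite h0 norm0.
have Tsa i : (i < p)%coq_nat -> (tomx K (T i))^t* = tomx K (T i).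
  by move=> /Tb [/mat_selfadjP].
pose F (a : 'I_N) := X (a * 4)%N.
have XF a : X (a * 4 + 1)%N = (X (a * 4)%N)^t*.
  by rewrite /X /ext_poly ext_d ext_c; apply: mx_ev_pstar Tsa _.
pose Xx i := X (i * 4 + 2)%N.
have Xxsa i : (Xx i)^t* = Xx i by rewrite /Xx /X /ext_poly ext_x; apply: mx_ev_psym_sa Tsa _.
have XT j : (j < p)%N -> X (j * 4 + 3)%N = tomx K (T j) by move=> hj; rewrite /X /ext_poly ext_y hj.
have Xpx P : evalMx X (px P) = evalMx Xx P by rewrite mx_ev_psubst.
have evH (a : 'I_N) : evalMx X (pH a) = F a *m (F ord0)^t* by rewrite /= (XF 0%N).
have evHs (a : 'I_N) : evalMx X (pHs a) = (F a *m (F ord0)^t*)^t*.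
  by rewrite /= XF adjM trmxCK.
have [] := @core_mx n K m r d F Xx.
- move=> a; apply: (@opb_le _ (1 + d)); first lra.
  apply: (key_le (vc a)); last by rewrite ext_gen_c norm_unitB.
  by do 6 (apply: List.in_or_app; right); apply: List.in_or_app; left; apply: in_tab.
- move=> a b; have := @key0 (rel1 a b).
  have -> : evalMx X (rel1 a b) = (F a)^t* *m F b - (a == b)%:R *: ((F ord0)^t* *m F ord0).
    rewrite mx_evB /= XF; congr (_ - _); rewrite -(inj_eq val_inj) /=.
    by case: eqP => _; rewrite ?mx_ev0 ?scale0r // scale1r /= (XF 0%N).
  apply; last by apply: ext_gen_rel1; exact: ltn_ord.
  by apply: List.in_or_app; left; exact: (@in_tab2 N rel1 a b (ltn_ord a) (ltn_ord b)).
- move=> a; have := @key0 (rel2 a).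
  have -> : evalMx X (rel2 a) = F a *m ((F ord0)^t* *m F ord0) - F a.
    by rewrite mx_evB /= (XF 0%N).
  by apply; [apply: List.in_or_app; right; apply: List.in_or_app; left; apply: in_tab|apply: ext_gen_rel2].
- have := @key0 (rel3 N).
  have -> : evalMx X (rel3 N) = \sum_a F a *m (F a)^t* - 1%:M.
    by rewrite mx_evB mx_ev1 mx_ev_psumn; congr (_ - _); apply: eq_bigr => a _; rewrite /= XF.
  by apply; [do 2 (apply: List.in_or_app; right); apply: List.in_or_app; left; left|apply: ext_gen_rel3].
- by rewrite mulrC.
- move=> i /ssrnat.ltP hi; apply: (@opb_le _ (cnorm (x i) + d)).
    by apply: le_trans (hr i hi); rewrite lerD2l.
  apply: (key_le (vx i)); last by rewrite ext_gen_x norm_phi.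
  by do 7 (apply: List.in_or_app; right); apply: in_tab.
- by move=> i _; apply: Xxsa.
- move=> i /ssrnat.ltP hi; have := @key0 (rel4 N i).
  have -> : evalMx X (rel4 N i) =
     Xx i - \sum_a (F a *m (F ord0)^t*) *m Xx i *m (F a *m (F ord0)^t*)^t*.
    rewrite mx_evB mx_ev_psumn; congr (_ - _); apply: eq_bigr => a _.
    by rewrite -evHs -evH.
  by apply; [do 3 (apply: List.in_or_app; right); apply: List.in_or_app; left; apply: in_tab|apply: ext_gen_rel4].
- exact: ltW.
move=> k [U [[UU U1] hA lip hS5]].
pose a i := (U ord0)^t* *m Xx i *m U ord0; exists k, U, a; split=> //.
  split=> [i hi|P hP].
    have [h1 h2] := hA i hi; rewrite mat_selfadjP ofmxK; split=> //; apply/RleP.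
    by apply/opnormP; rewrite // ofmxK.
  have vP : vars_lt m P by move/List.Forall_forall: vL'; apply.
  have [q [hq hX hmin]] : exists q : R, [/\ `|q - cnorm (evalA A x P)| <= d,
      opb q (evalMx Xx P) & forall c, opb c (evalMx Xx P) -> q <= c].
    rewrite -Xpx -(norm_phi tens) -(ext_gen_px tens p x y); apply: key.
    by do 5 (apply: List.in_or_app; right); apply: List.in_or_app; left; apply: List.in_map.
  set q' := mat_opnorm k (evalM k (fun i => ofmx (a i)) P).
  have hq' : opb q' (evalMx a P).
    have := opb_opnorm k (evalM k (fun i => ofmx (a i)) P); rewrite mx_evalM.
    by rewrite (_ : (fun i => _) = a) //; apply: funext => i; rewrite ofmxK.
  (* [ampl] preserves norm bounds in both directions, so the norms of P at the compression and at
     [Xx] differ by at most e; the latter is within d of the norm of P(x). *)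
  have lipP := lip P vP; set e := pC r P * (d * kap N r) in lipP.
  have e_le : e + d <= eps'.
    apply: le_trans hd2; rewrite mulrDr mulr1 lerD2r /e mulrCA ler_wpM2l ?(ltW d0) //.
    by rewrite ler_wpM2r // hM'.
  have h1 : q <= q' + e.
    apply: hmin; rewrite -[evalMx Xx P](subrK (ampl U (evalMx a P))) (addrC q').
    by apply: opbD lipP _; apply: opb_ampl.
  have h2 : q' <= q + e.
    apply/opnormP; first by rewrite addr_ge0 ?(opb_ge0 hX) ?(opb_ge0 lipP).
    rewrite mx_evalM (_ : (fun i => _) = a); last by apply: funext => i; rewrite ofmxK.
    apply: (opb_of_ampl UU).
    rewrite -[ampl _ _](subKr (evalMx Xx P)); apply: opbB => //.
  apply/RleP; rewrite RabsE RminusE -/q'; move: hq; rewrite !ler_norml => /andP [? ?].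
  by apply/andP; split; lra.
move=> j hj.
have h5 := hS5 (fun a b => S j a b) M M.
set Z := \sum_(s < N) _.
pose Y := \sum_(a < N) \sum_(b < N)
  F a *m (F ord0)^t* *m evalMx Xx (S j a b) *m (F b *m (F ord0)^t*)^t*.
have TY : opb (w1 / 4 + d) (tomx K (T j) - Y).
  have -> : tomx K (T j) - Y = evalMx X (rel5 N S j).
    rewrite mx_evB mx_ev_psumn; congr (_ - _); first by rewrite -XT.
    apply: eq_bigr => s _; rewrite mx_ev_psumn; apply: eq_bigr => t _.
    by rewrite -evHs -evH -Xpx.
  apply: key_le.
    by do 4 (apply: List.in_or_app; right); apply: List.in_or_app; left; apply: (in_tab (rel5 N S)).
  apply: le_trans (ext_gen_rel5 tens (e := w1 / 4 / (N%:R * N%:R)) hj _) _.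
    by move=> s t _ _; apply: ltW; have [] := hS j s t.
  by rewrite mulrA mulrC divfK // gt_eqF ?mulr_gt0.
have YZ : opb (N%:R * (N%:R * (d * K5))) (Y - Z).
  apply: h5 => s t; first by have [] := hS j s t.
    by have [] := hM j hj s (ltn_ord s) t (ltn_ord t).
  by have [] := hM j hj s (ltn_ord s) t (ltn_ord t).
rewrite -[tomx K (T j)](subrK Y) -addrA; apply: opb_le (opbD TY YZ).
have -> : N%:R * (N%:R * (d * K5)) = d * (N%:R * (N%:R * K5)) by ring.
by move: hd3; rewrite mulrDr mulr1; lra.
Qed.

End Core.

(** * Covering numbers *)

Lemma frob_of_norm2 n K T (w : R) : (0 < K)%N -> norm2 n K T < w ->
  forall i, (i < n)%N -> frob (w * Num.sqrt K%:R) (tomx K (T i)).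
Proof.
move=> K0; rewrite norm2E => h i hi.
have K0' : 0 < K%:R :> R by rewrite ltr0n.
have w0 : 0 <= w := le_trans (sqrtr_ge0 _) (ltW h).
split; first by rewrite mulr_ge0 ?sqrtr_ge0.
rewrite exprMn sqr_sqrtr ?ler0n // mulrC -ler_pdivrMl //.
move: h; rewrite -(ltr_sqr (sqrtr_ge0 _) w0) sqr_sqrtr; last first.
  by rewrite sumr_ge0 // => j _; rewrite mulr_ge0 ?fro2_ge0 ?invr_ge0 ?ler0n.
move/ltW; apply: le_trans; rewrite (bigD1 (Ordinal hi)) //= lerDl.
by rewrite sumr_ge0 // => j _; rewrite mulr_ge0 ?fro2_ge0 ?invr_ge0 ?ler0n.
Qed.

(** The crude sqrt n <= n + 1 provides a factor that is positive even for n = 0. *)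
Lemma norm2_le n K T (b : R) : (0 < K)%N ->
  (forall i, (i < n)%N -> frob (b * Num.sqrt K%:R) (tomx K (T i))) ->
  0 <= b -> norm2 n K T <= n.+1%:R * b.
Proof.
move=> K0 h b0; rewrite norm2E.
have K0' : 0 < K%:R :> R by rewrite ltr0n.
rewrite -[leRHS]ger0_norm ?mulr_ge0 // -sqrtr_sqr ler_wsqrtr //.
apply: (@le_trans _ _ (\sum_(i < n) b ^+ 2)).
  apply: ler_sum => i _; have [_] := h i (ltn_ord i).
  by rewrite exprMn sqr_sqrtr ?ler0n // ler_pdivrMl // mulrC.
rewrite sumr_const card_ord exprMn -[leLHS]mulr_natl ler_wpM2r ?sqr_ge0 //.
by rewrite -natrX ler_nat; nia.
Qed.

Lemma evalMx_conj k (V : 'M[C]_k) (a : nat -> 'M[C]_k) P :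
  V^t* *m V = 1%:M -> V *m V^t* = 1%:M ->
  evalMx (fun i => V *m a i *m V^t*) P = V *m evalMx a P *m V^t*.
Proof.
move=> h1 h2; elim: P => [i|q|P IHP Q IHQ|P IHP Q IHQ] //=.
- by rewrite mul_mx_scalar -scalemxAl h2 scalemx1.
- by rewrite IHP IHQ mulmxDr mulmxDl.
- by rewrite IHP IHQ !mulmxA -(mulmxA _ (V^t*) V) h1 mulmx1.
Qed.

Section Near.
Variables (A : CStarAlgebra) (n m p : nat) (x : nat -> A).
Variables (r eps w1 c w' w : R) (L : seq ncpoly) (S : nat -> nat -> nat -> ncpoly).
Local Notation N := n.+1.
Hypothesis r0 : 0 <= r.
Hypothesis vS : forall j a b, vars_lt m (S j a b).
Hypothesis Sc : forall j, (j < p)%N -> forall a, (a < N)%N -> forall b, (b < N)%N ->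
  pC r (S j a b) <= c.
Hypothesis c0 : 0 <= c.
Hypothesis w10 : 0 < w1.
Hypothesis w'0 : 0 < w'.
Hypothesis small : p.+1%:R * (2 * w1 + N%:R * (N%:R * (c * (2 * w')))) < w.

(** The total in [small]: 2 w1 from the two models, and 2 w' multiplied by the Lipschitz constant c
    in each of the N^2 blocks; the factor p + 1 comes from [norm2_le]. *)
Lemma model_near K k T T' U U' (a a' : nat -> 'M[C]_k) (Cn : nat -> mat) : (0 < K)%N ->
  @matrix_model A n m p x r eps L S w1 K k T U a ->
  @matrix_model A n m p x r eps L S w1 K k T' U' a' ->
  in_orbit_ball m k w' Cn (fun i => ofmx (a i)) ->
  in_orbit_ball m k w' Cn (fun i => ofmx (a' i)) ->
  in_orbit_ball p K w T' T.
Proof.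
move=> K0 [UU U1 [Ga _] hT] [UU' U1' [Ga' _] hT'].
move=> [W1 [/unitaryP [u1 u1'] /RltP h1]] [W2 [/unitaryP [u2 u2'] /RltP h2]].
have KE : K = (N * k)%N := dim_ampl UU U1.
have k0 : (0 < k)%N by move: K0; rewrite KE muln_gt0.
have kK : Num.sqrt k%:R <= Num.sqrt K%:R :> R.
  by rewrite ler_wsqrtr // ler_nat KE leq_pmull.
set V1 := tomx k W1 in u1 u1'; set V2 := tomx k W2 in u2 u2'.
(* Passing through the common centre, conjugation by [V] carries a' to within 2 w' of a. *)
pose V := V1 *m V2^t*.
have vv : V^t* *m V = 1%:M.
  by rewrite /V adjM trmxCK !mulmxA -(mulmxA _ (V1^t*)) u1 mulmx1 u2'.
have vv' : V *m V^t* = 1%:M.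
  by rewrite /V adjM trmxCK !mulmxA -(mulmxA _ (V2^t*)) u2 mulmx1 u1'.
have V1b := opb_isom vv.
have V1b' := opb_adj V1b.
have har i : (i < m)%coq_nat -> opb r (a i).
  by move=> /Ga [_ /RleP /opnormP]; rewrite ofmxK; apply.
have har' i : (i < m)%coq_nat -> opb r (V *m a' i *m V^t*).
  move=> /Ga' [_ /RleP /opnormP]; rewrite ofmxK => /(_ r0) h.
  by rewrite -[r]mul1r -[1 * r]mulr1; apply: opbM => //; apply: opbM.
have hd i : (i < m)%coq_nat -> frob (2 * w' * Num.sqrt k%:R) (a i - V *m a' i *m V^t*).
  move=> /ssrnat.ltP hi.
  have := frob_of_norm2 k0 h1 hi; rewrite mx_msub !mx_mmul mx_madj ofmxK -/V1 => f1.
  have := frob_of_norm2 k0 h2 hi; rewrite mx_msub !mx_mmul mx_madj ofmxK -/V2 => f2.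
  have -> : a i - V *m a' i *m V^t* = (a i - V1 *m tomx k (Cn i) *m V1^t*) -
     V *m (a' i - V2 *m tomx k (Cn i) *m V2^t*) *m V^t*.
    have e : V *m (V2 *m tomx k (Cn i) *m V2^t*) *m V^t* = V1 *m tomx k (Cn i) *m V1^t*.
      rewrite /V adjM trmxCK !mulmxA -(mulmxA _ (V2^t*) V2) u2 mulmx1.
      by rewrite -(mulmxA _ (V2^t*) V2) u2 mulmx1.
    by rewrite mulmxBr mulmxBl e opprB addrA subrK.
  have -> : 2 * w' * Num.sqrt k%:R = w' * Num.sqrt k%:R + 1 * (w' * Num.sqrt k%:R) * 1 by ring.
  by apply: frobB => //; apply: frob_opr => //; apply: frob_opl.
clearbody V.
(* [Q] intertwines the two systems of isometries: it maps the block form built on U' and a' to the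
   one built on U and the conjugate of a' by [V]. *)
pose Q := \sum_s U s *m V *m (U' s)^t*.
have QU s : Q *m U' s = U s *m V.
  rewrite mulmx_suml (bigD1 s) //= -mulmxA UU' eqxx mulmx1 big1 ?addr0 // => t ts.
  by rewrite -mulmxA UU' (negbTE ts) raddf0 mulmx0.
have QQ : Q *m Q^t* = 1%:M.
  rewrite {2}/Q adj_sum mulmx_sumr -U1; apply: eq_bigr => s _.
  by rewrite !adjM trmxCK !mulmxA QU -(mulmxA _ V) vv' mulmx1.
clearbody Q; have QQ' : Q^t* *m Q = 1%:M by apply: mulmx1C.
have Q1 := opb_isom QQ'.
have Q1' := opb_adj Q1.
exists (ofmx Q); split; first by apply/unitaryP; rewrite ofmxK.
apply/RltP; apply: le_lt_trans small; apply: norm2_le => //; last first.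
  by rewrite addr_ge0 ?mulr_ge0 // ltW.
move=> j hj; rewrite mx_msub !mx_mmul mx_madj ofmxK.
have := opb_frob (hT j hj); set Y := \sum_(s < N) _ => f1.
have := opb_frob (hT' j hj); set Y' := \sum_(s < N) _ => f2.
have QY : Q *m Y' *m Q^t* =
    \sum_(s < N) \sum_(t < N) U s *m (V *m evalMx a' (S j s t) *m V^t*) *m (U t)^t*.
  rewrite mulmx_sumr mulmx_suml; apply: eq_bigr => s _.
  rewrite mulmx_sumr mulmx_suml; apply: eq_bigr => t _.
  by rewrite !mulmxA QU -!mulmxA -adjM QU adjM !mulmxA.
have -> : tomx K (T j) - Q *m tomx K (T' j) *m Q^t* =
    (tomx K (T j) - Y) - Q *m (tomx K (T' j) - Y') *m Q^t* + (Y - Q *m Y' *m Q^t*).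
  rewrite mulmxBr mulmxBl; set u := tomx K (T j); set v := Q *m tomx K (T' j) *m Q^t*.
  set z := Q *m Y' *m Q^t*; by rewrite addrAC addrA subrK opprB addrA subrK.
have f3 : frob (N%:R * (N%:R * (1 * (c * (2 * w' * Num.sqrt k%:R)) * 1))) (Y - Q *m Y' *m Q^t*).
  rewrite QY -sumrB; apply: frob_sum => s; rewrite -sumrB; apply: frob_sum => t.
  rewrite -mulmxBl -mulmxBr; apply: frob_opr; last exact: opb_adj (U_isom UU t).
  apply: frob_opl; first exact: U_isom UU s.
  rewrite -evalMx_conj //.
  apply: frob_le (frob_evalMx_lip har har' hd (vS j s t)).
  by rewrite ler_wpM2r ?Sc // mulr_ge0 ?sqrtr_ge0 // mulr_ge0 // ltW.
have f4 : frob (1 * (w1 * Num.sqrt K%:R) * 1) (Q *m (tomx K (T' j) - Y') *m Q^t*).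
  by apply: frob_opr => //; apply: frob_opl.
apply: frob_le (frobD (frobB f1 f4) f3).
have h : N%:R * (N%:R * (c * (2 * w'))) * Num.sqrt k%:R <=
   N%:R * (N%:R * (c * (2 * w'))) * Num.sqrt K%:R.
  by rewrite ler_wpM2l // !mulr_ge0 // ltW.
by move: h; rewrite !mulrA => h; lra.
Qed.

End Near.

(** Every index related to some point of [G] is replaced by one such point, the others are dropped.
    The new centres lie in [G], as [o2] demands, and their number does not grow. *)
Lemma cover_transfer (X Y : Type) (G : Y -> Prop) (rel : X -> Y -> Prop)
  (near : Y -> Y -> Prop) (Ls : list X) :
  (forall x y y', G y -> G y' -> rel x y -> rel x y' -> near y' y) ->
  (forall y, G y -> exists x, In x Ls /\ rel x y) ->
  exists Ls', [/\ (length Ls' <= length Ls)%N, forall y, In y Ls' -> G y &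
    forall y, G y -> exists y', In y' Ls' /\ near y' y].
Proof.
move=> hn hc.
suff [Ls' [h1 h2 h3]] : exists Ls', [/\ (length Ls' <= length Ls)%N,
    forall y, In y Ls' -> G y &
    forall y, G y -> (exists x, In x Ls /\ rel x y) -> exists y', In y' Ls' /\ near y' y].
  by exists Ls'; split=> // y hy; apply: h3 hy (hc y hy).
elim: {hc} Ls => [|x Ls [Ls' [h1 h2 h3]]]; first by exists nil; split=> // y _ [x []].
have [[z [Gz xz]]|no] := pselect (exists z, G z /\ rel x z).
  exists (cons z Ls'); split=> // [y [<-//|/h2 //]|y Gy [u [[<-|hu] uy]]].
    by exists z; split; [left|apply: hn Gy Gz uy xz].
  by have [|y' [hy' ny]] := h3 y Gy; [exists u|exists y'; split=> //; right].
exists Ls'; split=> // [|y Gy [u [[xu|hu] uy]]]; first exact: leqW.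
  by case: no; exists y; rewrite xu.
by apply: h3 => //; exists u.
Qed.

(** Sizes K that are not multiples of N contribute -oo; the others K = N k are compared with k,
    which tends to infinity with K. *)
Lemma limsup_le N (u v : nat -> Rbar) :
  (forall K, (0 < K)%N -> u K = MInf \/ exists k, K = (N * k)%N /\ Rbar_le (u K) (v k)) ->
  Rbar_le (limsup_seq u) (limsup_seq v).
Proof.
move=> h; have [_ glb] := Rbar_infP (fun z => exists M : nat,
  z = Rbar_sup (fun y => exists k, (M <= k)%coq_nat /\ y = v k)).
apply: glb => _ [M ->]; have [lb _] := Rbar_infP (fun z => exists M : nat,
  z = Rbar_sup (fun y => exists k, (M <= k)%coq_nat /\ y = u k)).
(* The tail from N M + 1 ensures both K > 0 and k >= M. *)
apply: Rbar_le_trans (lb _ (ex_intro _ (N * M).+1 erefl)) _.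
have [_ lub] := Rbar_supP (fun y => exists k, ((N * M).+1 <= k)%coq_nat /\ y = u k).
apply: lub => _ [K [/ssrnat.leP hK ->]].
have [|->//|[k [KE huv]]] := h K; first exact: leq_ltn_trans hK.
apply: Rbar_le_trans huv _.
have [ub _] := Rbar_supP (fun y => exists k, (M <= k)%coq_nat /\ y = v k).
apply: ub; exists k; split=> //; apply/ssrnat.leP.
by move: hK; rewrite KE; nia.
Qed.

Lemma ln_le (u v : R) : Rlt 0 u -> Rle u v -> Rle (ln u) (ln v).
Proof.
move=> u0 [uv|->]; last exact: Rle_refl.
exact/Rlt_le/ln_increasing.
Qed.

(** The bound 1 <= b makes ln b nonnegative, so that dividing by K^2 instead of k^2 lowers it. It
    will hold because [x] has a microstate of size k. *)
Lemma Rbar_log_div_le (a b : Rbar) K k : (0 < k)%N -> (k <= K)%N ->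
  Rbar_le (Fin 1) b -> Rbar_le a b -> Rbar_le (Rbar_log_div a K) (Rbar_log_div b k).
Proof.
move=> k0 kK; case: a b => [a||] [b||] //= b1 ab.
  case: Rle_dec => // a0; have a0' := Rnot_le_lt _ _ a0.
  case: Rle_dec => [b0|_]; first by move: (Rle_trans _ _ _ b1 b0); Lra.lra.
  have e M : Rmult (INR M) (Rmult (INR M) 1) = M%:R ^+ 2 by rewrite Rmult_1_r INRE.
  apply/RleP; rewrite !e !RdivE.
  have k1 : 0 < k%:R :> R by rewrite ltr0n.
  have K1 : 0 < K%:R :> R by rewrite ltr0n (leq_trans k0).
  have lnab : ln a <= ln b by apply/RleP/ln_le.
  have lnb : 0 <= ln b by have := ln_le Rlt_0_1 b1; rewrite ln_1 => /RleP.
  apply: (@le_trans _ _ (ln b / K%:R ^+ 2)).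
    by rewrite ler_pM2r // invr_gt0 exprn_gt0.
  rewrite ler_wpM2l // lef_pV2 ?posrE ?exprn_gt0 //.
  by rewrite ler_sqr ?nnegrE ?ler_nat ?ler0n.
by case: Rle_dec.
Qed.

(** * Comparison of covering numbers and of orbit dimensions *)

Section Main.
Variables (A B : CStarAlgebra) (n : nat) (Psi : B -> nat -> nat -> A).
Hypothesis tens : is_tensor_Mn A n.+1 B Psi.
Variables (m p : nat) (x : nat -> A) (y : nat -> B).
Hypothesis xsa : forall i, cstar (x i) = x i.
Hypothesis genx : generates A x m.
Hypothesis ysa : forall j, (j < p)%coq_nat -> cstar (y j) = y j.
Hypothesis geny : generates B y p.
Local Notation N := n.+1.

Lemma cover_bound (w : R) : 0 < w -> exists w0 r : R, [/\ 0 < w0, 0 < r &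
  forall w', 0 < w' -> w' < w0 -> forall (eps' : R) L', 0 < eps' -> Forall (vars_lt m) L' ->
  exists (eps : R) L, 0 < eps /\ Forall (vars_lt p) L /\ forall Rr K, (0 < K)%N ->
    (forall T, ~ Gamma_top B y p Rr K eps L T) \/
    exists k, K = (N * k)%N /\ (exists T, Gamma_top A x m r k eps' L' T) /\
      Rbar_le (o2 p K (Gamma_top B y p Rr K eps L) w) (o2 m k (Gamma_top A x m r k eps' L') w')].
Proof.
move=> w0; have [r [r0 hr]] := norm_radius m x.
(* Budget: the two models cost 2 (p + 1) w1 = w / 2, and w' is restricted so that the remaining term
   is at most w / 4. *)
pose w1 : R := w / 4 / p.+1%:R.
have p0 : 0 < p.+1%:R :> R by rewrite ltr0n.
have w10 : 0 < w1 by rewrite !divr_gt0.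
have pw1 : p.+1%:R * w1 = w / 4 by rewrite /w1 mulrC divfK // gt_eqF.
have [S [vS hS]] := matrix_model_ex tens xsa genx ysa geny r0 hr w10.
have [c [c0 hc]] : exists c : R, 0 <= c /\ forall j, (j < p)%N -> forall a, (a < N)%N ->
    forall b, (b < N)%N -> pC r (S j a b) <= c.
  apply: common_bound => [j|j c c' cc h a ha b hb]; last exact: le_trans (h a ha b hb) cc.
  have [|a c c' cc h b hb|c [_ hc]] := @common_bound N (fun a c => forall b, (b < N)%N ->
     pC r (S j a b) <= c); [|exact: le_trans (h b hb) cc|by exists c].
  move=> a; have [b|b c c' cc h|c [_ hc]] := @common_bound N (fun b c => pC r (S j a b) <= c).
  - by exists (pC r (S j a b)).
  - exact: le_trans cc.
  - by exists c.
have D0 : 0 <= p.+1%:R * (N%:R * (N%:R * (c * 2))) :> R by rewrite !mulr_ge0.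
have w4 : 0 < w / 4 by rewrite divr_gt0.
have [d [d0 hd]] := small_factor D0 w4.
exists d, r; split=> // w' w'0 w'd eps' L' eps'0 vL'.
have small : p.+1%:R * (2 * w1 + N%:R * (N%:R * (c * (2 * w')))) < w.
  have := hd w' (ltW w'0) (ltW w'd).
  have -> : p.+1%:R * (2 * w1 + N%:R * (N%:R * (c * (2 * w')))) =
    2 * (p.+1%:R * w1) + w' * (p.+1%:R * (N%:R * (N%:R * (c * 2)))) by ring.
  by rewrite pw1; lra.
have [eps [L [eps0 [vL hL]]]] := hS eps' L' eps'0 vL'.
exists eps, L; split=> //; split=> // Rr K K0.
have [ne|em] := pselect (exists T, Gamma_top B y p Rr K eps L T); last first.
  by left=> T hT; apply: em; exists T.
right; have [T0 /hL [k [U0 [a0 mm0]]]] := ne.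
have KE : K = (N * k)%N by case: mm0 => UU U1 _ _; apply: dim_ampl UU U1.
exists k; split=> //; split; first by case: mm0 => _ _ Ga _; exists (fun i => ofmx (a0 i)).
have model T : Gamma_top B y p Rr K eps L T -> exists (U : 'I_N -> 'M[C]_(K, k)) a,
    @matrix_model A n m p x r eps' L' S w1 K k T U a.
  move=> /hL [k' [U [a mm]]].
  have kk : k' = k.
    case: (mm) => UU U1 _ _; have := dim_ampl UU U1; rewrite {1}KE => /eqP.
    by rewrite eqn_mul2l /= => /eqP.
  by move: U a mm; rewrite kk => U a mm; exists U, a.
have [_ glb] := Rbar_infP (fun q => exists Ls : list (nat -> mat), q = Fin (INR (length Ls)) /\
  (forall Z, In Z Ls -> Gamma_top A x m r k eps' L' Z) /\
  (forall T, Gamma_top A x m r k eps' L' T -> exists Z, In Z Ls /\ in_orbit_ball m k w' Z T)).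
apply: glb => _ [Ls [-> [_ cov]]].
pose rel (Z T : nat -> mat) := exists (U : 'I_N -> 'M[C]_(K, k)) a,
    @matrix_model A n m p x r eps' L' S w1 K k T U a /\
    in_orbit_ball m k w' Z (fun i => ofmx (a i)).
have [||Ls' [h1 h2 h3]] := @cover_transfer _ _ (Gamma_top B y p Rr K eps L) rel
  (in_orbit_ball p K w) Ls.
- move=> Z T T' _ _ [U [a [mm ball]]] [U' [a' [mm' ball']]].
  exact: (model_near (ltW r0) vS hc c0 w10 w'0 small K0 mm mm' ball ball').
- move=> T /model [U [a mm]]; case: (mm) => _ _ /cov [Z [hZ ball]] _.
  by exists Z; split=> //; exists U, a.
have [lb _] := Rbar_infP (fun q => exists Ls : list (nat -> mat), q = Fin (INR (length Ls)) /\
  (forall Z, In Z Ls -> Gamma_top B y p Rr K eps L Z) /\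
  (forall T, Gamma_top B y p Rr K eps L T -> exists Z, In Z Ls /\ in_orbit_ball p K w Z T)).
apply: (@Rbar_le_trans (Fin (INR (length Ls')))); first by apply: lb; exists Ls'.
by rewrite /=; apply/RleP; rewrite !INRE ler_nat.
Qed.

Lemma o2_ge1 (k : nat) (G : (nat -> mat) -> Prop) (w : R) :
  (exists T, G T) -> Rbar_le (Fin 1) (o2 m k G w).
Proof.
move=> [T GT]; have [_ glb] := Rbar_infP (fun q => exists Ls : list (nat -> mat),
  q = Fin (INR (length Ls)) /\ (forall Z, In Z Ls -> G Z) /\
  (forall T, G T -> exists Z, In Z Ls /\ in_orbit_ball m k w Z T)).
apply: glb => _ [Ls [-> [_ cov]]].
have [Z [hZ _]] := cov T GT; case: Ls hZ {cov} => // u Ls _.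
have h : 1 <= (length (u :: Ls))%:R :> R by rewrite ler1n.
by apply/RleP; rewrite INRE.
Qed.

Lemma o2_empty (k : nat) (G : (nat -> mat) -> Prop) (w : R) K :
  (forall T, ~ G T) -> Rbar_log_div (o2 k K G w) K = MInf.
Proof.
move=> em.
have [lb glb] := Rbar_infP (fun q => exists Ls : list (nat -> mat),
  q = Fin (INR (length Ls)) /\ (forall Z, In Z Ls -> G Z) /\
  (forall T, G T -> exists Z, In Z Ls /\ in_orbit_ball k K w Z T)).
have : Rbar_le (o2 k K G w) (Fin 0).
  by apply: lb; exists nil; split=> //; split=> // T /em.
by case: (o2 k K G w) => [s||] //= s0; case: Rle_dec.
Qed.

(** Each cutoff [Rr] in the supremum for [y] is compared with the single cutoff r for [x]. *)
Lemma Ktop_omega_le (w : R) : 0 < w -> exists w0 : R, 0 < w0 /\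
  forall w', 0 < w' -> w' < w0 -> Rbar_le (Ktop_omega B y p w) (Ktop_omega A x m w').
Proof.
move=> /cover_bound [w0 [r [w00 r0 H]]]; exists w0; split=> // w' w'0 w'w0.
have [_ lub] := Rbar_supP (fun s => exists Rr, Rlt 0 Rr /\ s =
    Rbar_inf (fun t => exists eps L, Rlt 0 eps /\ Forall (vars_lt p) L /\ t =
      limsup_seq (fun k => Rbar_log_div (o2 p k (Gamma_top B y p Rr k eps L) w) k))).
apply: lub => _ [Rr [_ ->]].
have [ub _] := Rbar_supP (fun s => exists Rr, Rlt 0 Rr /\ s =
    Rbar_inf (fun t => exists eps L, Rlt 0 eps /\ Forall (vars_lt m) L /\ t =
      limsup_seq (fun k => Rbar_log_div (o2 m k (Gamma_top A x m Rr k eps L) w') k))).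
apply: Rbar_le_trans (ub _ (ex_intro _ r (conj (RltP r0) erefl))).
have [_ glb] := Rbar_infP (fun t => exists eps L, Rlt 0 eps /\ Forall (vars_lt m) L /\ t =
      limsup_seq (fun k => Rbar_log_div (o2 m k (Gamma_top A x m r k eps L) w') k)).
apply: glb => _ [eps' [L' [/RltP eps'0 [vL' ->]]]].
have [eps [L [eps0 [vL hK]]]] := H w' w'0 w'w0 eps' L' eps'0 vL'.
have [lb _] := Rbar_infP (fun t => exists eps L, Rlt 0 eps /\ Forall (vars_lt p) L /\ t =
      limsup_seq (fun k => Rbar_log_div (o2 p k (Gamma_top B y p Rr k eps L) w) k)).
have := lb _ (ex_intro _ eps (ex_intro _ L (conj (RltP eps0) (conj vL erefl)))).
move/Rbar_le_trans; apply; apply: (@limsup_le N) => K K0.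
have [em|[k [KE [ne le]]]] := hK Rr K K0; first by left; apply: o2_empty.
right; exists k; split=> //; apply: Rbar_log_div_le le.
- by move: K0; rewrite KE muln_gt0.
- by rewrite KE leq_pmull.
- exact: o2_ge1.
Qed.

(** Given d, every w in (0, 1) is dominated by some w' below d, so the supremum over the fixed
    interval (0, 1) on the y side already suffices. *)
Lemma Ktop_le : Rbar_le (Ktop B y p) (Ktop A x m).
Proof.
have [_ glb] := Rbar_infP (fun z => exists d, Rlt 0 d /\ z =
  Rbar_sup (fun y => exists w, (Rlt 0 w /\ Rlt w d) /\ y = Ktop_omega A x m w)).
apply: glb => _ [d [/RltP d0 ->]].
have [lb _] := Rbar_infP (fun z => exists d, Rlt 0 d /\ z =
  Rbar_sup (fun y0 => exists w, (Rlt 0 w /\ Rlt w d) /\ y0 = Ktop_omega B y p w)).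
apply: Rbar_le_trans (lb _ (ex_intro _ 1 (conj (RltP ltr01) erefl))) _.
have [_ lub] := Rbar_supP (fun y0 => exists w, (Rlt 0 w /\ Rlt w 1) /\ y0 = Ktop_omega B y p w).
apply: lub => _ [w [[/RltP w0 _] ->]].
have [w1 [w10 hw]] := Ktop_omega_le w0.
pose w' : R := Num.min d w1 / 2.
have m0 : 0 < Num.min d w1 by rewrite lt_min d0.
have w'0 : 0 < w' by rewrite divr_gt0.
have w'm : w' < Num.min d w1 by rewrite /w'; lra.
move: w'm; rewrite lt_min => /andP [w'd w'1].
apply: Rbar_le_trans (hw w' w'0 w'1) _.
have [ub _] := Rbar_supP (fun y => exists w, (Rlt 0 w /\ Rlt w d) /\ y = Ktop_omega A x m w).
by apply: ub; exists w'; split=> //; split; apply/RltP.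
Qed.

End Main.

Lemma Gamma_top_ext (A : CStarAlgebra) (x z : nat -> A) m r k eps L T :
  (forall i, (i < m)%coq_nat -> x i = z i) -> Forall (vars_lt m) L ->
  Gamma_top A x m r k eps L T -> Gamma_top A z m r k eps L T.
Proof.
move=> xz vL [h1 h2]; split=> // P hP; rewrite -(ev_ext xz); first exact: h2.
by move/List.Forall_forall: vL; apply.
Qed.

Lemma Ktop_ext (A : CStarAlgebra) (x z : nat -> A) m :
  (forall i, (i < m)%coq_nat -> x i = z i) -> Ktop A x m = Ktop A z m.
Proof.
move=> xz; have zx i : (i < m)%coq_nat -> z i = x i by move/xz.
congr limsup_0plus; apply: funext => w; congr Rbar_sup; apply: funext => s.
apply: propext; split=> -[Rr [R0 ->]]; exists Rr; split=> //;
  congr Rbar_inf; apply: funext => t; apply: propext; split=> -[eps [L [e0 [vL ->]]]];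
  exists eps, L; split=> //; split=> //; congr limsup_seq; apply: funext => k;
  congr (Rbar_log_div (o2 _ _ _ _) _); apply: funext => T; apply: propext; split;
  exact: Gamma_top_ext.
Qed.

Lemma generates_ext (A : CStarAlgebra) (x z : nat -> A) m :
  (forall i, (i < m)%coq_nat -> x i = z i) -> generates A x m -> generates A z m.
Proof.
move=> xz g S h1 h2; apply: g => // i hi; rewrite xz //; exact: h2.
Qed.

Lemma Ktop_tensor_le (A : CStarAlgebra) (n : nat) (B : CStarAlgebra)
  (Psi : B -> nat -> nat -> A) (m p : nat) (x : nat -> A) (y : nat -> B) :
  (1 <= n)%coq_nat -> is_tensor_Mn A n B Psi ->
  (forall i, (i < m)%coq_nat -> self_adjoint A (x i)) -> generates A x m ->
  (forall j, (j < p)%coq_nat -> self_adjoint B (y j)) -> generates B y p ->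
  Rbar_le (Ktop B y p) (Ktop A x m).
Proof.
case: n => [/ssrnat.leP//|n] _ tens xsa genx ysa geny.
(* Padding by zero makes all entries self-adjoint, as the extended tuple uses x_i for every natural
   number i; [Ktop] sees only the first m. *)
pose x' i : A := if (i < m)%N then x i else 0.
have xx' i : (i < m)%coq_nat -> x i = x' i by move=> /ssrnat.ltP hi; rewrite /x' hi.
have x'sa i : cstar (x' i) = x' i.
  by rewrite /x'; case: ifP => [/ssrnat.ltP /xsa//|_]; apply: star0.
rewrite (Ktop_ext xx').
exact (Ktop_le tens x'sa (generates_ext xx' genx) ysa geny).
Qed.

End TensorMatrix.

Theorem theorem3p4 (A : CStarAlgebra) (n : nat) (B : CStarAlgebra)
  (Psi : B -> nat -> nat -> A) (m p : nat) (x : nat -> A) (y : nat -> B) :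
  (1 <= n)%nat ->
  is_tensor_Mn A n B Psi ->
  (forall i, (i < m)%nat -> self_adjoint A (x i)) ->
  generates A x m ->
  (forall j, (j < p)%nat -> self_adjoint B (y j)) ->
  generates B y p ->
  Rbar_le (Ktop B y p) (Ktop A x m).
Proof.
exact (@TensorMatrix.Ktop_tensor_le A n B Psi m p x y).
Qed.
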